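(* Assume each $f_k$ ($k=1,\dots,n$) is $L_k$-smooth and $\mu_k$-strongly convex ($\mu_k\ge0$), and that $$\sigma_*^2=\frac1n\sum_{k=1}^n\mathbb E_{\xi^{(k)}\sim\mathcal D_k}\|\nabla f(\mathbf x^*;\xi^{(k)})-\nabla f_k(\mathbf x^* )\|^2,\qquad \zeta_*^2=\frac1n\sum_{k=1}^n\|\nabla f_k(\mathbf x^* )\|^2$$ are finite. Let $L=\max_kL_k$ and $\mu=\min_k\mu_k$. Start from $\mathbf x_0$ with $\|\mathbf x_0-\mathbf x^*\|\le B$, and run Local SGD for $T$ iterations with $\mathrm{gap}(\mathcal I_T)=E\ge1$ and an appropriately tuned constant learning rate $\eta\le\Theta(\frac1{\mu+LE})$. Then the output $\hat{\mathbf x}$ satisfies: if $\mu=0$, $$\mathbb E[f(\hat{\mathbf x})-f(\mathbf x^* )]=O\Big(\frac{LEB^2}{T}+\frac{B\sigma_*}{\sqrt{nT}}+\frac{\sqrt[3]{(E-1)LB^4}}{T^{2/3}}\Big[E\zeta_*^2+\frac{n-1}{n}\sigma_*^2\Big]^{1/3}\Big),$$ and if $\mu>0$, $$\mathbb E[f(\hat{\mathbf x})-f(\mathbf x^* )]=\widetilde O\Big(LEB^2\exp\Big(-\Theta\Big(\frac{\mu T}{LE}\Big)\Big)+\frac{\sigma_*^2}{n\mu T}+\frac{(E-1)L}{\mu^2T^2}\Big[E\zeta_*^2+\frac{n-1}{n}\sigma_*^2\Big]\Big),$$ no matter whether the data distributions $\mathcal D_1,\dots,\mathcal D_n$ are identical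 or not.
   Context: There are $n$ machines; machine $k$ has data distribution $\mathcal D_k$ and local objective $f_k(\mathbf x)=\mathbb E_{\xi\sim\mathcal D_k}f(\mathbf x;\xi)$ on $\mathbb R^d$. The global objective is $f(\mathbf x)=\frac1n\sum_{k=1}^nf_k(\mathbf x)$ with minimizer $\mathbf x^*$ (assumed to exist). ''$f_k$ is $L_k$-smooth'' means that for every sample $\xi$ of $\mathcal D_k$, $f(\cdot;\xi)$ is convex, differentiable, with $L_k$-Lipschitz gradient; ''$\mu_k$-strongly convex'' means $f_k(\mathbf y)-f_k(\mathbf x)\ge\langle\nabla f_k(\mathbf x),\mathbf y-\mathbf x\rangle+\frac{\mu_k}2\|\mathbf x-\mathbf y\|^2$ for all $\mathbf x,\mathbf y$; $\nabla f_k(\mathbf x)=\mathbb E_{\xi\sim\mathcal D_k}\nabla f(\mathbf x;\xi)$. Local SGD: $\mathbf x_0^{(k)}=\mathbf x_0$ for all $k$. For $t=1,\dots,T$, each machine $k$ sets $\mathbf x_t^{(k)}=\mathbf x_{t-1}^{(k)}-\eta\nabla f(\mathbf x_{t-1}^{(k)};\xi_{t-1}^{(k)})$ with $\xi_{t-1}^{(k)}\sim\mathcal D_k$, all samples independent across $k$ and $t$; if $t\in\mathcal I_T$, every $\mathbf x_t^{(k)}$ is replaced by the average $\frac1n\sum_{j=1}^n\mathbf x_t^{(j)}$. Output $\hat{\mathbf x}=\frac1{nW_T}\sum_{j=0}^{T-1}(1-\mu\eta)^{T-j-1}\sum_{k=1}^n\mathbf x_j^{(k)}$ with $W_T=\sum_{j=0}^{T-1}(1-\mu\eta)^{T-j-1}$.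 $\mathrm{gap}(\mathcal I_T)$ is the largest difference between consecutive elements of $\mathcal I_T$ in sorted order, where $0$ and $T$ are counted as elements. $O,\Theta$ hide absolute constants; $\widetilde O$ additionally hides logarithmic factors. *)

(* Defs.v *)
From HB Require Import structures.
From mathcomp Require Import all_boot all_order all_algebra.
From mathcomp Require Import all_classical all_reals all_analysis.

Set Implicit Arguments.
Unset Strict Implicit.
Unset Printing Implicit Defensive.

Import Order.TTheory GRing.Theory Num.Theory.
Import numFieldNormedType.Exports.

Local Open Scope classical_set_scope.
Local Open Scope ring_scope.

(* The norm that the library puts on ['rV[R]_d] is the sup norm, so the
   Euclidean structure of R^d is introduced here. (Both norms induce the same
   topology, hence the library's [differentiable] is the usual notion.) *)
Definition dotv (R : realType) (d : nat) (u v : 'rV[R]_d) : R :=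
  \sum_(i < d) u 0 i * v 0 i.

Definition norm2 (R : realType) (d : nat) (u : 'rV[R]_d) : R :=
  Num.sqrt (dotv u u).

Definition grad (R : realType) (d : nat) (g : 'rV[R]_d -> R) (x : 'rV[R]_d) :
    'rV[R]_d :=
  \row_(i < d) 'D_(delta_mx 0 i) g x.

Definition convex_smooth (R : realType) (d : nat) (L : R) (g : 'rV[R]_d -> R) :=
  [/\ convex_function (setT : set (convex_lmodType 'rV[R]_d)) g,
      (forall x, differentiable g x) &
      forall x y, norm2 (grad g x - grad g y) <= L * norm2 (x - y)].

Section Objectives.
(* Machine [k] draws its samples from its own space [Xi k]: "for every sample
   of [D k]" is then the quantification over all points of [Xi k]. A loss [f]
   on a common sample space is covered by taking for [Xi k] the support of
   [D k]. *)
Context (R : realType) (n d : nat) (dX : measure_display).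
Variables (Xi : 'I_n -> measurableType dX).
Variables (D : forall k, probability (Xi k) R).
Variable (f : forall k, 'rV[R]_d -> Xi k -> R).

Definition local_obj (k : 'I_n) (x : 'rV[R]_d) : R :=
  \int[D k]_xi f x xi.

Definition global_obj (x : 'rV[R]_d) : R :=
  n%:R^-1 * \sum_(k < n) local_obj k x.

Definition sgrad (k : 'I_n) (x : 'rV[R]_d) (xi : Xi k) : 'rV[R]_d :=
  grad (fun y => f y xi) x.

Definition local_grad (k : 'I_n) (x : 'rV[R]_d) : 'rV[R]_d :=
  \row_(i < d) \int[D k]_xi (sgrad x xi 0 i).

Definition strongly_convex (k : 'I_n) (mu : R) :=
  forall x y, dotv (local_grad k x) (y - x) + mu / 2 * norm2 (x - y) ^+ 2
              <= local_obj k y - local_obj k x.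

(* Extended-real valued: it may be infinite. *)
Definition noise_at (x : 'rV[R]_d) : \bar R :=
  ((n%:R^-1)%:E *
   \sum_(k < n) \int[D k]_xi (norm2 (sgrad x xi - local_grad k x) ^+ 2)%:E)%E.

Definition heterogeneity_at (x : 'rV[R]_d) : R :=
  n%:R^-1 * \sum_(k < n) norm2 (local_grad k x) ^+ 2.

(* [s t k] is the sample used by machine [k] to go from step [t] to [t.+1];
   [I] lists the synchronization times. *)
Fixpoint local_sgd (x0 : 'rV[R]_d) (eta : R) (I : seq nat)
    (s : nat -> forall k, Xi k) (t : nat) : 'I_n -> 'rV[R]_d :=
  if t is t'.+1 then
    let x := local_sgd x0 eta I s t' in
    let y k := x k - eta *: sgrad (x k) (s t' k) in
    if t \in I then fun=> n%:R^-1 *: \sum_(j < n) y j else y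
  else fun=> x0.

Definition sgd_output (mu : R) (T : nat) (x0 : 'rV[R]_d) (eta : R) (I : seq nat)
    (s : nat -> forall k, Xi k) : 'rV[R]_d :=
  let w j := (1 - mu * eta) ^+ (T - j - 1) in
  (n%:R * \sum_(j < T) w j)^-1 *:
    \sum_(j < T) w j *: \sum_(k < n) local_sgd x0 eta I s j k.

End Objectives.

Definition gap (T : nat) (I : seq nat) : nat :=
  let s := sort leq (undup [:: 0, T & I])%N in
  (\max_(i < (size s).-1) (nth 0 s i.+1 - nth 0 s i))%N.

(* The product rule is only required for the full (finite) family: the rule for
   a subfamily follows by taking [A i = setT] for the other indices. *)
Definition mutually_independent (R : realType) (dO dE : measure_display)
    (Omega : measurableType dO) (P : probability Omega R) (J : finType)
    (E : J -> measurableType dE) (X : forall i, Omega -> E i) :=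
  forall A : (forall i, set (E i)), (forall i, measurable (A i)) ->
    P (\bigcap_(i in [set: J]) (X i @^-1` A i)) =
    (\prod_(i : J) P (X i @^-1` A i))%E.

Definition is_max (R : realType) (n : nat) (u : 'I_n -> R) (M : R) :=
  (exists k, u k = M) /\ (forall k, u k <= M).

Definition is_min (R : realType) (n : nat) (u : 'I_n -> R) (m : R) :=
  (exists k, u k = m) /\ (forall k, m <= u k).

Section Rates.
Context (R : realType).
Variables (n T E : nat) (L mu B sigma zeta : R).

Definition drift : R := E%:R * zeta ^+ 2 + (n%:R - 1) / n%:R * sigma ^+ 2.

Definition convex_rate : R :=
  L * E%:R * B ^+ 2 / T%:R
  + B * sigma / Num.sqrt (n%:R * T%:R)
  + ((E%:R - 1) * L * B ^+ 4) `^ (3^-1) / T%:R `^ (2 / 3) * drift `^ (3^-1).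

Definition stochastic_terms : R :=
  sigma ^+ 2 / (n%:R * mu * T%:R)
  + (E%:R - 1) * L / (mu ^+ 2 * T%:R ^+ 2) * drift.

(* [c] is the constant hidden by the Theta in the exponent. *)
Definition strongly_convex_rate (c : R) : R :=
  L * E%:R * B ^+ 2 * expR (- (c * (mu * T%:R / (L * E%:R))))
  + stochastic_terms.

(* The logarithm hidden by the tilde: tuning the learning rate balances
   [mu * B ^+ 2 * expR (- mu * eta * T)] against [stochastic_terms]. When the
   latter vanish, division by 0 being 0, the factor is 1. *)
Definition log_factor : R := 1 + ln (1 + mu * B ^+ 2 / stochastic_terms).

End Rates.

(* Main.v *)
Require Import Defs.
From HB Require Import structures.
From mathcomp Require Import all_boot all_order all_algebra.
From mathcomp Require Import all_classical all_reals all_analysis.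
From mathcomp Require Import measurable_realfun zify ring lra.

Set Implicit Arguments.
Unset Strict Implicit.
Unset Printing Implicit Defensive.

Import Order.TTheory GRing.Theory Num.Theory.
Import numFieldNormedType.Exports.

Local Open Scope classical_set_scope.
Local Open Scope ring_scope.

(* Let x_t be the mean of the machine iterates. It performs an SGD step in which
   machine k evaluates its gradient at x_t^(k) instead of x_t. The three-point
   identity for Bregman divergences, together with smoothness and cocoercivity,
   turns this into
     r_(t+1) <= (1 - mu eta) r_t - 2 eta e_t + 2 eta L v_t
                + eta^2 (4 L^2 v_t + 16 L e_t + 2 sigma^2 / n),
   where r_t is the mean square distance to x*, e_t the expected suboptimality
   of x_t and v_t the mean spread of the machines around x_t. All gradients are
   compared with the gradients of the same samples at x*, so that only the noise
   at x* appears; it is centered and independent of the past and of the other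
   samples. Unrolling the iteration back to the last synchronization, fewer than
   E steps before, bounds v_t by eta^2 times
     (E - 1) sum (L^2 v_i + L e_i) + (E - 1) (E zeta^2 + (n - 1) / n sigma^2)
   up to constants. Summing with the weights (1 - mu eta)^(T - t - 1), which vary
   by at most a factor 2 over a window of length E, and absorbing the v_i and e_i
   terms thanks to eta L E <= 1 / 64, gives a bound on the output by Jensen's
   inequality. It remains to tune eta. If mu > 0, eta is the minimum of
   1 / (64 (mu + L E)) and Lambda / (mu T), with Lambda the logarithmic factor.

   Conditional expectations are avoided: a function of a sample and of variables
   independent of it is integrated by Tonelli's theorem. *)

(** * Euclidean vectors and smooth convex functions *)

Section Euclidean.
Context (R : realType) (d : nat).
Implicit Types (u v w : 'rV[R]_d) (a : R).

Lemma dotvC u v : dotv u v = dotv v u.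
Proof. by apply: eq_bigr => i _; rewrite mulrC. Qed.

Lemma dotvDl u v w : dotv (u + v) w = dotv u w + dotv v w.
Proof. by rewrite -big_split; apply: eq_bigr => i _; rewrite !mxE mulrDl. Qed.

Lemma dotvZl a u w : dotv (a *: u) w = a * dotv u w.
Proof. by rewrite mulr_sumr; apply: eq_bigr => i _; rewrite !mxE mulrA. Qed.

Lemma dotvNl u w : dotv (- u) w = - dotv u w.
Proof. by rewrite -scaleN1r dotvZl mulN1r. Qed.

Lemma dotv0l w : dotv 0 w = 0.
Proof. by rewrite -(scale0r 0) dotvZl mul0r. Qed.

Lemma dotv_suml (I : Type) (r : seq I) (p : pred I) (F : I -> 'rV[R]_d) w :
  dotv (\sum_(i <- r | p i) F i) w = \sum_(i <- r | p i) dotv (F i) w.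
Proof.
by elim/big_rec2: _ => [|i y x _ <-]; [exact: dotv0l | rewrite dotvDl].
Qed.

Lemma dotvDr u v w : dotv w (u + v) = dotv w u + dotv w v.
Proof. by rewrite dotvC dotvDl !(dotvC w). Qed.

Lemma dotvZr a u w : dotv w (a *: u) = a * dotv w u.
Proof. by rewrite dotvC dotvZl dotvC. Qed.

Lemma dotvNr u w : dotv w (- u) = - dotv w u.
Proof. by rewrite dotvC dotvNl dotvC. Qed.

Lemma dotv_sumr (I : Type) (r : seq I) (p : pred I) (F : I -> 'rV[R]_d) w :
  dotv w (\sum_(i <- r | p i) F i) = \sum_(i <- r | p i) dotv w (F i).
Proof. by rewrite dotvC dotv_suml; apply: eq_bigr => i _; rewrite dotvC. Qed.

Definition dotvE := (dotvDl, dotvDr, dotvNl, dotvNr, dotvZl, dotvZr).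

Lemma dotv_ge0 u : 0 <= dotv u u.
Proof. by apply: sumr_ge0 => i _; rewrite -expr2 sqr_ge0. Qed.

Lemma norm2_ge0 u : 0 <= norm2 u.
Proof. exact: sqrtr_ge0. Qed.

Lemma norm2_sqr u : norm2 u ^+ 2 = dotv u u.
Proof. by rewrite sqr_sqrtr ?dotv_ge0. Qed.

Lemma dotvBC u v : dotv (u - v) (u - v) = dotv (v - u) (v - u).
Proof. by rewrite -opprB dotvNl dotvNr opprK. Qed.

Lemma dotv_young u v : 2 * dotv u v <= dotv u u + dotv v v.
Proof.
have := dotv_ge0 (u - v); rewrite !dotvE (dotvC v u); lra.
Qed.

Lemma dotvD_le u v : dotv (u + v) (u + v) <= 2 * dotv u u + 2 * dotv v v.
Proof. have := dotv_young u v; rewrite !dotvE (dotvC v u); lra. Qed.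

Lemma dotvD3_le u v w : dotv (u + v + w) (u + v + w) <=
  3 * (dotv u u + dotv v v + dotv w w).
Proof.
have := dotv_young u v; have := dotv_young u w; have := dotv_young v w.
rewrite !dotvE (dotvC v u) (dotvC w u) (dotvC w v); lra.
Qed.

Lemma coord_sqr_le u i : u 0 i ^+ 2 <= dotv u u.
Proof.
by rewrite /dotv (bigD1 i)//= -expr2 lerDl sumr_ge0// => j _; rewrite -expr2 sqr_ge0.
Qed.

Lemma dotv_eq0 u : dotv u u <= 0 -> u = 0.
Proof.
move=> u0; apply/rowP => i; apply/eqP.
by rewrite mxE -sqrf_eq0 eq_le sqr_ge0 andbT (le_trans (coord_sqr_le _ _)).
Qed.

(** Young's inequality for [u] and [a *: v], divided by [a]. If [a = 0], the hypothesis forces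
    [u = 0]. *)
Lemma dotv_le_scale u v a : 0 <= a -> dotv u u <= a ^+ 2 * dotv v v ->
  dotv u v <= a * dotv v v.
Proof.
rewrite le_eqVlt => /predU1P[<-|a0 uv].
  by rewrite expr2 !mul0r => /dotv_eq0 ->; rewrite dotv0l.
have := dotv_young u (a *: v); rewrite !dotvE => h.
have {}h : a * dotv u v <= a * (a * dotv v v) by lra.
by rewrite ler_pM2l in h.
Qed.

(** Expand into a double sum and bound each product [dotv (F i) (F j)] by half the sum of the two
    squares. *)
Lemma dotv_sum_le (I : finType) (F : I -> 'rV[R]_d) :
  dotv (\sum_i F i) (\sum_i F i) <= #|I|%:R * \sum_i dotv (F i) (F i).
Proof.
have h i j : dotv (F i) (F j) <= 2^-1 * dotv (F i) (F i) + 2^-1 * dotv (F j) (F j).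
  by have := dotv_young (F i) (F j); lra.
rewrite dotv_suml.
have -> : #|I|%:R * \sum_i dotv (F i) (F i) =
    \sum_i \sum_j (2^-1 * dotv (F i) (F i) + 2^-1 * dotv (F j) (F j)).
  have hS (u : I -> R) a : \sum_j (a + u j) = #|I|%:R * a + \sum_j u j.
    by rewrite big_split sumr_const -(mulr_natl a).
  under [RHS]eq_bigr do rewrite hS -mulr_sumr addrC.
  by rewrite hS -!mulr_sumr; lra.
by apply: ler_sum => i _; rewrite dotv_sumr; apply: ler_sum => j _.
Qed.

Lemma dotv_sum_nat_le (s t : nat) (F : nat -> 'rV[R]_d) :
  dotv (\sum_(s <= i < t) F i) (\sum_(s <= i < t) F i) <=
  (t - s)%:R * \sum_(s <= i < t) dotv (F i) (F i).
Proof.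
have shift (V : nmodType) (G : nat -> V) :
    \sum_(s <= i < t) G i = \sum_(i < t - s) G (i + s)%N.
  by rewrite -{1}[s]add0n big_addn big_mkord.
by rewrite !shift; have := dotv_sum_le (fun i : 'I_(t - s) => F (i + s)%N); rewrite card_ord.
Qed.

(** The variance identity. It is kept as an equality because its negative term later produces the
    factor [(n - 1) / n] of [sigma ^+ 2]. *)
Lemma dotv_sum_center (I : finType) (F : I -> 'rV[R]_d)
    (m := #|I|%:R^-1 *: \sum_i F i) : (0 < #|I|)%N ->
  #|I|%:R^-1 * \sum_i dotv (F i - m) (F i - m) =
  #|I|%:R^-1 * (\sum_i dotv (F i) (F i)) - dotv m m.
Proof.
move=> I0; have I1 : #|I|%:R != 0 :> R by rewrite pnatr_eq0 -lt0n.
have sF : \sum_i F i = #|I|%:R *: m by rewrite scalerA mulfV// scale1r.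
have -> : \sum_i dotv (F i - m) (F i - m) =
    \sum_i (dotv (F i) (F i) + (- 2 * dotv (F i) m) + dotv m m).
  apply: eq_bigr => i _; rewrite !(dotvDl, dotvDr, dotvNl, dotvNr) (dotvC m (F i)); ring.
rewrite !big_split/= sumr_const -mulr_sumr -dotv_suml sF dotvZl.
by rewrite -mulr_natl; field.
Qed.

End Euclidean.

(** * Bregman divergences of smooth convex functions *)

Section Smooth.
Context (R : realType) (d : nat).
Implicit Types (x y z : 'rV[R]_d) (g : 'rV[R]_d -> R) (L : R).

Definition bregman g y x : R := g y - g x - dotv (grad g x) (y - x).

Lemma derive_grad g x v : differentiable g x -> 'D_v g x = dotv (grad g x) v.
Proof.
move=> dg; rewrite deriveE// [in LHS](row_sum_delta v) linear_sum.
by apply: eq_bigr => i _; rewrite linearZ mxE deriveE// mulrC.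
Qed.

(** A limit along a sequence lets the gradient inherit both the convexity inequality and the
    measurability of difference quotients. *)
Lemma derivable_cvg_seq g x v : derivable g x v ->
  k.+1%:R * (g (k.+1%:R^-1 *: v + x) - g x) @[k --> \oo] --> 'D_v g x.
Proof.
move=> dg.
have /cvgr_dnbhsP h := dg; rewrite -/('D_v g x) in h.
have := h (fun k => k.+1%:R^-1) (conj (fun k => _ : k.+1%:R^-1 != 0) cvg_harmonic).
by under eq_fun do rewrite /= invrK; apply => k; rewrite invr_eq0 pnatr_eq0.
Qed.

(** By convexity the difference quotient at [x] towards [y] never exceeds [g y - g x]; the step then
    tends to 0. *)
Lemma bregman_ge0 g L y x : convex_smooth L g -> 0 <= bregman g y x.
Proof.
case=> cg dg _; rewrite /bregman subr_ge0 -derive_grad//.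
apply: cvgr_to_le (derivable_cvg_seq (diff_derivable (dg x))) _; near=> k.
have k0 : 0 < k.+1%:R :> R by [].
rewrite mulrC -ler_pdivlMr// mulrC.
have k1 : k.+1%:R^-1 <= 1 :> R by rewrite invf_le1// ler1n.
have t0 : 0 <= k.+1%:R^-1 :> R by rewrite invr_ge0 ltW.
have := cg (Itv01 t0 k1) y x; rewrite !inE => /(_ I I).
have -> : conv (Itv01 t0 k1) (y : convex_lmodType _) x = k.+1%:R^-1 *: (y - x) + x.
  by rewrite /conv/= scalerBr /unstable.onem scalerBl scale1r addrA addrAC.
set s := k.+1%:R^-1; set a := g (_ + x) => h.
have {}h : a <= s * g y + (1 - s) * g x := h.
lra.
Unshelve. all: end_near.
Qed.

Lemma bregman_three_point g x y z :
  dotv (grad g z - grad g x) (y - x) =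
  bregman g y x - bregman g y z + bregman g x z.
Proof. by rewrite /bregman !dotvE; ring. Qed.

(* Adding the gradient inequalities at both ends costs a factor 2 over the
   optimal [L / 2], but needs no integration along the segment. *)
Lemma bregman_le g L y x : 0 <= L -> convex_smooth L g ->
  bregman g y x <= L * dotv (y - x) (y - x).
Proof.
move=> L0 cs; have [_ _ gL] := cs.
apply: le_trans (_ : dotv (grad g y - grad g x) (y - x) <= _).
  have := bregman_ge0 x y cs; rewrite /bregman !dotvE; lra.
apply: dotv_le_scale => //; rewrite -!norm2_sqr -exprMn.
by rewrite ler_sqr ?nnegrE ?mulr_ge0 ?norm2_ge0.
Qed.

Lemma grad_lipschitz g L y x : 0 <= L -> convex_smooth L g ->
  dotv (grad g y - grad g x) (grad g y - grad g x) <= L ^+ 2 * dotv (y - x) (y - x).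
Proof.
move=> L0 [_ _ gL]; rewrite -!norm2_sqr -exprMn.
by rewrite ler_sqr ?nnegrE ?mulr_ge0 ?norm2_ge0.
Qed.

Lemma bregman_trans g x y z :
  bregman g z x = bregman g z y + bregman g y x + dotv (grad g y - grad g x) (z - y).
Proof. by rewrite /bregman !dotvE; ring. Qed.

Lemma grad_cocoercive g L y x : 0 <= L -> convex_smooth L g ->
  dotv (grad g y - grad g x) (grad g y - grad g x) <= 4 * L * bregman g y x.
Proof.
rewrite le_eqVlt => /predU1P[<-|L0] cs.
  have := grad_lipschitz y x (lexx 0) cs; rewrite expr2 !mul0r mulr0 mul0r.
  by move=> /le_trans; apply.
have L1 : L != 0 by rewrite gt_eqF.
have /= hz z := bregman_trans g x y z.
move: (grad g y - grad g x) hz => u hz.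
(* Compare the Bregman divergence at [y] with the nonnegative one at [z]. *)
pose z := y - (2 * L)^-1 *: u.
have zy : z - y = - ((2 * L)^-1 *: u) by rewrite /z addrC addKr.
have := bregman_le z y (ltW L0) cs; have := bregman_ge0 z x cs.
rewrite hz !zy !dotvE opprK.
(* The step [(2 * L)^-1] minimizes [L * t ^+ 2 - t], with minimum [- (4 * L)^-1]; hence the constant
   4. *)
have -> : L * ((2 * L)^-1 * ((2 * L)^-1 * dotv u u)) = (4 * L)^-1 * dotv u u by field.
have -> : (2 * L)^-1 * dotv u u = 2 * ((4 * L)^-1 * dotv u u) by field.
move=> h0 h1; have : (4 * L)^-1 * dotv u u <= bregman g y x by lra.
by rewrite mulrC ler_pdivrMr ?mulr_gt0// mulrC.
Qed.

End Smooth.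

(** * Independent samples *)

Section Independence.
Context (R : realType).

(** The product rule on rectangles identifies the law of [(X, Y)] with the product of the law of [X]
    and [m]; Tonelli's theorem then applies. *)
Lemma tonelli_indep d0 d1 d2 (Omega : measurableType d0) (T1 : measurableType d1)
    (T2 : measurableType d2) (P : probability Omega R) (m : probability T2 R)
    (X : {mfun Omega >-> T1}) (Y : {mfun Omega >-> T2}) (F : T1 * T2 -> \bar R) :
  (forall A B, measurable A -> measurable B ->
     P (X @^-1` A `&` Y @^-1` B) = (P (X @^-1` A) * m B)%E) ->
  measurable_fun setT F -> (forall z, 0 <= F z)%E ->
  (\int[P]_w F (X w, Y w) = \int[P]_w \int[m]_z F (X w, z))%E.
Proof.
move=> indep mF F0.
pose XY w := (X w, Y w).
have mXY : measurable_fun setT XY by exact: measurable_fun_pair.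
pose Z : {mfun Omega >-> (T1 * T2)%type} :=
  HB.pack XY (isMeasurableFun.Build _ _ _ _ XY mXY).
rewrite -(ge0_integral_distribution Z mF F0).
transitivity (\int[distribution P X \x m]_z F z)%E.
  apply: eq_measure_integral => A mA _; apply/esym.
  exact: product_measure_unique.
rewrite fubini_tonelli1//.
rewrite (ge0_integral_distribution X)//; first exact: measurable_fun_fubini_tonelli_F.
by move=> y; apply: integral_ge0.
Qed.

Context (d1 d2 : measure_display) (Omega : measurableType d1) (P : probability Omega R).
Context (J : finType) (E : J -> measurableType d2).
Context (X : forall q, {mfun Omega >-> E q}).

(* The sigma-algebra on [Omega] generated by all samples but [X q]. Integrating
   out [X q] against it plays the role of conditional expectation. *)
Definition cylinder (q : J) : set (set Omega) :=
  [set A | exists B : forall q', set (E q'),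
    [/\ forall q', measurable (B q'), B q = setT &
        A = \bigcap_(q' in [set: J]) (X q' @^-1` B q')]].

Lemma cylinder_measurable q : cylinder q `<=` measurable.
Proof.
move=> _ [B [mB _ ->]]; apply: fin_bigcap_measurable => // i _.
exact: measurable_funPTI.
Qed.

Definition others q : measurableType _ := g_sigma_algebraType (cylinder q).

Lemma measurable_others q d (T : measurableType d) (g : Omega -> T) :
  measurable_fun setT (g : others q -> T) -> measurable_fun setT g.
Proof.
move=> mg _ A mA.
apply: (smallest_sub (@sigma_algebra_measurable _ Omega) (@cylinder_measurable q)).
exact: mg.
Qed.

(** A preimage under [X q'] is itself a cylinder: it constrains coordinate [q'] only, and
    [q' != q]. *)
Lemma others_measurable q q' : q' != q ->
  measurable_fun setT (X q' : others q -> E q').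
Proof.
move=> qq' _ A mA; rewrite setTI; apply: sub_sigma_algebra.
exists (dfwith (fun q => [set: E q]) q' A); split.
- by move=> r; have [<-|?] := eqVneq q' r; [rewrite dfwithin|rewrite dfwithout].
- by rewrite dfwithout.
- apply/seteqP; split=> [w Aw r _|w /(_ q' I)]; last by rewrite /preimage/= dfwithin.
  rewrite /preimage/=.
  have [rq|?] := eqVneq q' r; last by rewrite dfwithout.
  by case: r / rq; rewrite dfwithin.
Qed.

(** With [B] fixed, both sides are finite measures in [A]. They agree on cylinders by the product
    rule for the full family, and cylinders are stable under intersection and generate the
    sigma-algebra. *)
Lemma others_indep q A B : mutually_independent P (fun q => X q : Omega -> E q) ->
  measurable (A : set (others q)) -> measurable B ->
  P (A `&` X q @^-1` B) = (P A * P (X q @^-1` B))%E.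
Proof.
move=> indep mA mB.
have mXB := measurable_funPTI (X q) mB.
(* The scalar [c] turns the right-hand side into a scaled measure. *)
pose c : {nonneg R} := NngNum (fine_ge0 (measure_ge0 P (X q @^-1` B))).
have Pc : P (X q @^-1` B) = (c%:num)%:E by rewrite /= fineK// fin_num_measure.
rewrite Pc muleC -[RHS]/(mscale c P A) -[LHS]/(mrestr P mXB A).
apply: (@g_sigma_algebra_measure_unique _ R Omega (cylinder q)
  (@cylinder_measurable q) (fun=> setT)) => //.
- move=> _; exists (fun=> setT); split=> //.
  by apply/seteqP; split.
- by rewrite bigcup_const.
- move=> _ _ [A1 [mA1 A1q ->]] [A2 [mA2 A2q ->]].
  exists (fun r => A1 r `&` A2 r); split.
  + by move=> r; apply: measurableI.
  + by rewrite A1q A2q setTI.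
  + by rewrite bigcapI.
- move=> _ [C [mC Cq ->]].
  suff : (P (\bigcap_(r in [set: J]) (X r @^-1` C r) `&` X q @^-1` B) =
          P (X q @^-1` B) * P (\bigcap_(r in [set: J]) (X r @^-1` C r)))%E.
    by rewrite Pc.
  have -> : P (\bigcap_(r in [set: J]) (X r @^-1` C r)) =
      (\prod_(r | r != q) P (X r @^-1` C r))%E.
    have := indep C mC; rewrite (bigD1 q)//= Cq preimage_setT probability_setT mul1e.
    exact.
  (* Coordinate [q] of [C] is the full space; replacing it by [B] turns the intersection into a
     single product event. *)
  have mD r : measurable (dfwith C q B r).
    by have [<-|?] := eqVneq q r; [rewrite dfwithin|rewrite dfwithout].
  have := indep _ mD; rewrite (bigD1 q)//= dfwithin.
  under [X in _ = (_ * X)%E -> _]eq_bigr => r rq do rewrite dfwithout 1?eq_sym//.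
  move=> <-; congr (P _); apply/seteqP; split=> [w [Cw Bw] r _|w Cw].
    rewrite /preimage/=; have [qr|?] := eqVneq q r; last by rewrite dfwithout//; exact: Cw.
    by case: r / qr; rewrite dfwithin.
  split=> [r _|]; last by have := Cw q I; rewrite /preimage/= dfwithin.
  have := Cw r I; rewrite /preimage/=.
  by have [qr|?] := eqVneq q r; [case: r / qr; rewrite Cq|rewrite dfwithout].
- move=> _; apply: (@le_lt_trans _ _ 1%E); last exact: ltry.
  by apply: probability_le1; exact: measurableI.
Qed.

Lemma tonelli_others q (m : probability (E q) R) (F : others q * E q -> \bar R) :
  mutually_independent P (fun q => X q : Omega -> E q) ->
  (forall A, measurable A -> distribution P (X q) A = m A) ->
  measurable_fun setT F -> (forall z, 0 <= F z)%E ->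
  (\int[P]_w F (w, X q w) = \int[P]_w \int[m]_z F (w, z))%E.
Proof.
move=> indep dm mF F0.
(* The identity, seen as a variable with values in the coarser space, plays the role of [X] in
   [tonelli_indep]. *)
have mid : measurable_fun setT (id : Omega -> others q).
  by apply: measurable_others; exact: measurable_id.
pose p : {mfun Omega >-> others q} :=
  HB.pack (id : Omega -> others q) (isMeasurableFun.Build _ _ _ _ (id : Omega -> others q) mid).
apply: (@tonelli_indep _ _ _ _ _ _ P m p (X q)) => // A B mA mB.
rewrite -dm//; exact: others_indep.
Qed.

End Independence.

(** * Measurability of functions of a random point and a random sample *)

Section Caratheodory.
Context (R : realType) (d : nat).

Lemma cvg_row (u : nat -> 'rV[R]_d) (x : 'rV[R]_d) :
  (forall i, u m 0 i @[m --> \oo] --> x 0 i) -> u m @[m --> \oo] --> x.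
Proof.
move=> h; apply/cvg_ballP => e e0.
have {}h i : \forall m \near \oo, ball (x 0 i) e (u m 0 i).
  by move/cvg_ballP: (h i); apply.
have hm : \forall m \near \oo, forall i, ball (x 0 i) e (u m 0 i) by exact: filter_forall.
near=> m; split=> // i j; rewrite (ord1 i).
by move: j; near: m.
Unshelve. all: end_near.
Qed.

Lemma floor_cvg (x : R) : (Num.floor (m.+1%:R * x))%:~R / m.+1%:R @[m --> \oo] --> x.
Proof.
apply/cvgrPdist_le => e e0.
have := @cvg_harmonic R; move/cvgrPdist_le => /(_ e e0) []N _ hN.
exists N => // m /hN; rewrite sub0r normrN /harmonic ger0_norm ?invr_ge0// => h.
apply: le_trans h; have m0 : 0 < m.+1%:R :> R by [].
have := floor_itv (m.+1%:R * x); set k := Num.floor _ => /andP[k1 k2].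
rewrite ger0_norm ?subr_ge0 ?ler_pdivrMr// 1?mulrC//.
have -> : x = m.+1%:R^-1 * (m.+1%:R * x) by rewrite mulrA mulVf ?mul1r.
rewrite -mulrBr -[leRHS]mulr1 ler_wpM2l ?invr_ge0// lerBlDl.
by rewrite (le_trans (ltW k2))// intrD.
Qed.

(** This makes gradients and divergences measurable at random iterates, where measurability in the
    sample at each fixed point does not suffice. *)
Lemma measurable_comp_caratheodory dT dE (T : measurableType dT) (E : measurableType dE)
    (g : 'rV[R]_d -> E -> R) (X : T -> 'rV[R]_d) (Y : T -> E) :
  (forall x, measurable_fun setT (g x)) -> (forall z, continuous (g ^~ z)) ->
  (forall i, measurable_fun setT (fun w => X w 0 i)) -> measurable_fun setT Y ->
  measurable_fun setT (fun w => g (X w) (Y w)).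
Proof.
move=> mg cg mX mY.
(* Rounding [X] down to the grid of mesh [1 / (m + 1)] makes it countably valued. *)
pose v m (k : {ffun 'I_d -> int}) : 'rV[R]_d := \row_i ((k i)%:~R / m.+1%:R).
pose K m w := [ffun i => Num.floor (m.+1%:R * X w 0 i)].
apply: (measurable_fun_cvg (h := fun m w => g (v m (K m w)) (Y w))) => [m|w _]; last first.
  have vX : v m (K m w) @[m --> \oo] --> X w.
    by apply: cvg_row => i; under eq_fun do rewrite !mxE ffunE; exact: floor_cvg.
  exact: cvg_comp vX (cg (Y w) (X w)).
move=> _ A mA; rewrite setTI.
have -> : (fun w => g (v m (K m w)) (Y w)) @^-1` A =
    \bigcup_k ((K m @^-1` [set k]) `&` (Y @^-1` (g (v m k) @^-1` A))).
  apply/seteqP; split=> [w Aw|w [k _ [/= <-]]]//.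
  by exists (K m w).
apply: countable_bigcupT_measurable => [|k]; first exact: countableP.
apply: measurableI; last first.
  by rewrite -[X in measurable X]setTI; apply: mY => //; rewrite -[X in measurable X]setTI; apply: mg.
have -> : K m @^-1` [set k] = \bigcap_(i in [set: 'I_d])
    ((fun w => m.+1%:R * X w 0 i) @^-1` `[(k i)%:~R, (k i + 1)%:~R[%classic).
  apply/seteqP; split=> [w /= <- i _|w h].
    by rewrite /= in_itv/= ffunE -floor_eq.
  by apply/ffunP => i; rewrite ffunE; apply/eqP; rewrite floor_eq; have := h i I; rewrite /= in_itv.
apply: fin_bigcap_measurable => // i _; rewrite -[X in measurable X]setTI.
by apply: measurable_funM => //; exact: measurable_itv.
Qed.

End Caratheodory.

(** * Expectations *)

Section Expectation.
Context (R : realType) (dT : measure_display) (T : measurableType dT) (P : probability T R).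
Implicit Types (X Y : T -> R) (a : R).

Definition itg X := P.-integrable setT (EFin \o X).
Local Notation Ex X := (\int[P]_w X w).

Lemma itg_measurable X : itg X -> measurable_fun setT X.
Proof. by move=> /measurable_int/measurable_EFinP. Qed.

Lemma itgD X Y : itg X -> itg Y -> itg (fun w => X w + Y w).
Proof. by move=> iX iY; exact: (integrableD measurableT iX iY). Qed.

Lemma itgB X Y : itg X -> itg Y -> itg (fun w => X w - Y w).
Proof. by move=> iX iY; exact: (integrableB measurableT iX iY). Qed.

Lemma itgZ a X : itg X -> itg (fun w => a * X w).
Proof. by move=> iX; exact: (integrableZl measurableT a iX). Qed.

Lemma itg_cst a : itg (fun=> a).
Proof. exact: finite_measure_integrable_cst. Qed.

Lemma itg_sum (I : Type) (r : seq I) (p : pred I) (F : I -> T -> R) :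
  (forall i, p i -> itg (F i)) -> itg (fun w => \sum_(i <- r | p i) F i w).
Proof.
move=> iF; elim: r => [|i r IH].
  by under eq_fun do rewrite big_nil; exact: itg_cst.
under eq_fun do rewrite big_cons.
by case pi: (p i) => //; apply: itgD => //; exact: iF.
Qed.

Lemma itg_le X Y : measurable_fun setT X -> itg Y ->
  (forall w, `|X w| <= Y w) -> itg X.
Proof.
move=> mX iY XY; apply: (le_integrable measurableT _ _ iY).
  exact/measurable_EFinP.
by move=> w _ /=; rewrite lee_fin (le_trans (XY w))// ler_norm.
Qed.

Lemma ExD X Y : itg X -> itg Y -> Ex (fun w => X w + Y w) = Ex X + Ex Y.
Proof. by move=> iX iY; rewrite RintegralD. Qed.

Lemma ExB X Y : itg X -> itg Y -> Ex (fun w => X w - Y w) = Ex X - Ex Y.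
Proof. by move=> iX iY; rewrite RintegralB. Qed.

Lemma ExZ a X : itg X -> Ex (fun w => a * X w) = a * Ex X.
Proof. by move=> iX; rewrite RintegralZl. Qed.

Lemma Ex_cst a : Ex (fun=> a) = a.
Proof. by rewrite -[LHS]/(Rintegral P setT (cst a)) Rintegral_cst//= probability_setT mulr1. Qed.

Lemma Ex_sum (I : Type) (r : seq I) (p : pred I) (F : I -> T -> R) :
  (forall i, p i -> itg (F i)) ->
  Ex (fun w => \sum_(i <- r | p i) F i w) = \sum_(i <- r | p i) Ex (F i).
Proof.
move=> iF; elim: r => [|i r IH].
  by under eq_Rintegral do rewrite big_nil; rewrite Ex_cst big_nil.
under eq_Rintegral do rewrite big_cons.
rewrite big_cons; case: ifPn => // pi.
by rewrite ExD ?IH//; [exact: iF | exact: itg_sum].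
Qed.

Lemma Ex_le X Y : itg X -> itg Y -> (forall w, X w <= Y w) -> Ex X <= Ex Y.
Proof. by move=> iX iY XY; apply: le_Rintegral. Qed.

Lemma integral_Ex X : itg X -> (\int[P]_w (X w)%:E)%E = (Ex X)%:E.
Proof. by move=> iX; rewrite fineK//; exact: integrable_fin_num. Qed.

Definition sqitg X := measurable_fun setT X /\ itg (fun w => X w ^+ 2).

Lemma sqitg_le X Y : measurable_fun setT X -> itg Y -> (forall w, X w ^+ 2 <= Y w) -> sqitg X.
Proof.
move=> mX iY XY; split=> //; apply: itg_le iY _; first exact: measurable_funX.
by move=> w; rewrite ger0_norm ?sqr_ge0.
Qed.

Lemma sqitg_mul X Y : sqitg X -> sqitg Y -> itg (fun w => X w * Y w).
Proof.
move=> [mX iX] [mY iY]; apply: (itg_le _ (itgD iX iY)).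
  exact: measurable_funM.
move=> w; rewrite ler_norml; apply/andP; split.
  by have := sqr_ge0 (X w + Y w); have := sqr_ge0 (X w); have := sqr_ge0 (Y w); rewrite sqrrD; lra.
by have := sqr_ge0 (X w - Y w); have := sqr_ge0 (X w); have := sqr_ge0 (Y w); rewrite sqrrB; lra.
Qed.

Lemma sqitgD X Y : sqitg X -> sqitg Y -> sqitg (fun w => X w + Y w).
Proof.
move=> [mX iX] [mY iY]; apply: (sqitg_le _ (itgD (itgZ 2 iX) (itgZ 2 iY))).
  exact: measurable_funD.
by move=> w; have := sqr_ge0 (X w - Y w); rewrite sqrrB sqrrD; lra.
Qed.

Lemma sqitgZ a X : sqitg X -> sqitg (fun w => a * X w).
Proof.
move=> [mX iX]; split; first exact: measurable_funM.
by under eq_fun do rewrite exprMn; exact: itgZ.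
Qed.

Lemma sqitg_cst a : sqitg (fun=> a).
Proof. by split=> //; exact: itg_cst. Qed.

Lemma sqitg_itg X : sqitg X -> itg X.
Proof. by move=> sX; have := sqitg_mul sX (sqitg_cst 1); under eq_fun do rewrite mulr1. Qed.

Context (d : nat).
Implicit Types (U V : T -> 'rV[R]_d).

(** The domain is a separate parameter, so that a map on [Omega] can also be required to be
    measurable for the coarser [others q]. *)
Definition vmeas d' (T' : measurableType d') (U : T' -> 'rV[R]_d) :=
  forall i, measurable_fun setT (fun w => U w 0 i).

Definition vsqitg U := forall i, sqitg (fun w => U w 0 i).

Lemma vsqitg_meas U : vsqitg U -> vmeas U.
Proof. by move=> sU i; have [] := sU i. Qed.

Lemma vsqitgD U V : vsqitg U -> vsqitg V -> vsqitg (fun w => U w + V w).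
Proof. by move=> sU sV i; under eq_fun do rewrite mxE; exact: sqitgD. Qed.

Lemma vsqitgZ a U : vsqitg U -> vsqitg (fun w => a *: U w).
Proof. by move=> sU i; under eq_fun do rewrite mxE; exact: sqitgZ. Qed.

Lemma vsqitgB U V : vsqitg U -> vsqitg V -> vsqitg (fun w => U w - V w).
Proof.
move=> sU sV; have := vsqitgD sU (vsqitgZ (-1) sV).
by under eq_fun do rewrite scaleN1r.
Qed.

Lemma vsqitg_cst u : vsqitg (fun=> u).
Proof. by move=> i; exact: sqitg_cst. Qed.

Lemma vsqitg_sum (I : Type) (r : seq I) (p : pred I) (F : I -> T -> 'rV[R]_d) :
  (forall i, p i -> vsqitg (F i)) -> vsqitg (fun w => \sum_(i <- r | p i) F i w).
Proof.
move=> iF; elim: r => [|i r IH].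
  by under eq_fun do rewrite big_nil; exact: vsqitg_cst.
under eq_fun do rewrite big_cons.
by case pi: (p i) => //; apply: vsqitgD => //; exact: iF.
Qed.

Lemma itg_dotv U V : vsqitg U -> vsqitg V -> itg (fun w => dotv (U w) (V w)).
Proof. by move=> sU sV; apply: itg_sum => i _; exact: sqitg_mul. Qed.

Lemma vsqitg_le U (Y : T -> R) : vmeas U -> itg Y ->
  (forall w, dotv (U w) (U w) <= Y w) -> vsqitg U.
Proof.
move=> mU iY UY i; apply: (sqitg_le (mU i) iY) => w.
exact: le_trans (coord_sqr_le _ _) (UY w).
Qed.

End Expectation.
Arguments itg {R dT T} P X.
Arguments sqitg {R dT T} P X.
Arguments vsqitg {R dT T} P {d} U.

Section VectorMeasurable.
Context (R : realType) (d : nat) (dT : measure_display) (T : measurableType dT).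
Implicit Types U V : T -> 'rV[R]_d.

Lemma vmeasB U V : vmeas U -> vmeas V -> vmeas (fun w => U w - V w).
Proof. by move=> mU mV i; under eq_fun do rewrite !mxE; exact: measurable_funB. Qed.

Lemma vmeasZ (a : R) U : vmeas U -> vmeas (fun w => a *: U w).
Proof. by move=> mU i; under eq_fun do rewrite mxE; exact: measurable_funM. Qed.

Lemma vmeas_cst (u : 'rV[R]_d) : vmeas (fun _ : T => u).
Proof. by move=> i; exact: measurable_cst. Qed.

Lemma vmeas_sum (I : Type) (r : seq I) (F : I -> T -> 'rV[R]_d) :
  (forall i, vmeas (F i)) -> vmeas (fun w => \sum_(i <- r) F i w).
Proof.
by move=> mF i; under eq_fun do rewrite summxE; apply: measurable_sum => j; exact: mF.
Qed.

End VectorMeasurable.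

Section Continuity.
Context (R : realType).

Lemma cvgr_sum (T I : Type) (F : set_system T) (FF : Filter F) (r : seq I)
    (u : I -> T -> R) (l : I -> R) :
  (forall i, u i x @[x --> F] --> l i) ->
  \sum_(i <- r) u i x @[x --> F] --> \sum_(i <- r) l i.
Proof.
move=> ul; elim: r => [|i r IH].
  by under eq_fun do rewrite big_nil; rewrite big_nil; exact: cvg_cst.
by under eq_fun do rewrite big_cons; rewrite big_cons; exact: cvgD.
Qed.

Lemma cvg_dotv (d : nat) (T : Type) (F : set_system T) (FF : Filter F)
    (u v : T -> 'rV[R]_d) (a b : 'rV[R]_d) :
  (forall i, u x 0 i @[x --> F] --> a 0 i) -> (forall i, v x 0 i @[x --> F] --> b 0 i) ->
  dotv (u x) (v x) @[x --> F] --> dotv a b.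
Proof. by move=> ua vb; apply: cvgr_sum => i; exact: cvgM. Qed.

Lemma nbhs_row_filter (d : nat) (x : 'rV[R]_d) : Filter (nbhs x).
Proof. exact: (@nbhs_filter 'rV[R]_d x). Qed.

Lemma cvg_subv (d : nat) (x : 'rV[R]_d) i : (y - x) 0 i @[y --> x] --> (0 : 'rV[R]_d) 0 i.
Proof.
rewrite -(subrr x) !mxE; under eq_fun do rewrite !mxE.
have FF := nbhs_row_filter x.
apply: cvgB; [exact: (@coord_continuous R 1 d 0 i x)|exact: cvg_cst].
Qed.

Lemma continuous_dotv_sub (d : nat) (x : 'rV[R]_d) :
  dotv (y - x) (y - x) @[y --> x] --> (0 : R).
Proof.
rewrite -[X in _ --> X](dotv0l (0 : 'rV[R]_d)).
by apply: cvg_dotv; [exact: nbhs_row_filter|exact: cvg_subv|exact: cvg_subv].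
Qed.

End Continuity.

(** * The loss of one machine and its expectation *)

Section Sample.
Context (R : realType) (d : nat) (dE : measure_display) (E : measurableType dE).
Context (m : probability E R) (h : 'rV[R]_d -> E -> R) (L : R).
Hypothesis L0 : 0 <= L.
Hypothesis ih : forall x, itg m (h x).
Hypothesis csh : forall z, convex_smooth L (h^~ z).

Local Notation G x z := (grad (h^~ z) x).
Local Notation H x := (\int[m]_z h x z).
Local Notation GH x := (\row_i \int[m]_z G x z 0 i).

Lemma differentiable_sample z x : differentiable (h^~ z) x.
Proof. by have [] := csh z. Qed.

Lemma continuous_sample z : continuous (h^~ z).
Proof. by move=> x; exact/differentiable_continuous/differentiable_sample. Qed.

Lemma measurable_sample x : measurable_fun setT (h x).
Proof. exact/itg_measurable/ih. Qed.

(** Each partial derivative is the limit of a sequence of difference quotients, which are measurable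
    in the sample. *)
Lemma measurable_grad x : vmeas (fun z => G x z).
Proof.
move=> i; apply: (measurable_fun_cvg
  (h := fun k z => k.+1%:R * (h (k.+1%:R^-1 *: delta_mx 0 i + x) z - h x z))).
  move=> k; apply: measurable_funM => //.
  by apply: measurable_funB; exact: measurable_sample.
move=> z _; rewrite mxE; apply: derivable_cvg_seq.
exact/diff_derivable/differentiable_sample.
Qed.

Lemma continuous_grad z i (x : 'rV[R]_d) : G y z 0 i @[y --> x] --> G x z 0 i.
Proof.
have FF := nbhs_row_filter x.
apply/cvgrPdist_le => e e0.
(* The summand 1 avoids a division by 0 when [L = 0]. *)
have e1 : 0 < e ^+ 2 / (L ^+ 2 + 1) by rewrite divr_gt0 ?exprn_gt0 ?ltr_wpDl ?sqr_ge0.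
have := continuous_dotv_sub x; move/cvgrPdist_le => /(_ _ e1); apply: filterS => y.
rewrite sub0r normrN ger0_norm ?dotv_ge0// => yx.
rewrite -ler_sqr ?nnegrE ?(ltW e0)// real_normK ?num_real//.
have := coord_sqr_le (G x z - G y z) i; rewrite !mxE => /le_trans; apply.
apply: le_trans (grad_lipschitz _ _ L0 (csh z)) _; rewrite dotvBC.
move: yx; rewrite ler_pdivlMr ?ltr_wpDl ?sqr_ge0// => yx.
by apply: le_trans yx; rewrite mulrC ler_wpM2l ?dotv_ge0 ?lerDl.
Qed.

Lemma continuous_bregman_l z (x y : 'rV[R]_d) :
  bregman (h^~ z) u x @[u --> y] --> bregman (h^~ z) y x.
Proof.
have FF := nbhs_row_filter y.
apply: cvgB; first by apply: cvgB; [exact: continuous_sample|exact: cvg_cst].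
apply: cvg_dotv => i; first exact: cvg_cst.
under eq_fun do rewrite !mxE; rewrite !mxE.
by apply: cvgB; [exact: (@coord_continuous R 1 d 0 i y)|exact: cvg_cst].
Qed.

Lemma continuous_bregman_r z (x y : 'rV[R]_d) :
  bregman (h^~ z) x u @[u --> y] --> bregman (h^~ z) x y.
Proof.
have FF := nbhs_row_filter y.
apply: cvgB; first by apply: cvgB; [exact: cvg_cst|exact: continuous_sample].
apply: cvg_dotv => i; first exact: continuous_grad.
under eq_fun do rewrite !mxE; rewrite !mxE.
by apply: cvgB; [exact: cvg_cst|exact: (@coord_continuous R 1 d 0 i y)].
Qed.

Lemma itg_grad x i : itg m (fun z => G x z 0 i).
Proof.
(* By convexity the partial derivative lies between the backward and the
   forward unit differences, which are integrable. *)
pose u := x + delta_mx 0 i; pose v := x - delta_mx 0 i.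
have iB y : itg m (fun z => `|h y z - h x z|).
  by have /integrable_norm := itgB (ih y) (ih x).
apply: (itg_le (measurable_grad x i) (itgD (iB u) (iB v))) => z.
have Gi w : dotv (G x z) (w *: delta_mx 0 i) = w * G x z 0 i.
  rewrite dotvZr /dotv (bigD1 i)//= big1 ?addr0; first by rewrite !mxE !eqxx mulr1.
  by move=> j ji; rewrite !mxE (negbTE ji) andbF mulr0.
have := bregman_ge0 u x (csh z); have := bregman_ge0 v x (csh z).
have ux : u - x = 1 *: delta_mx 0 i by rewrite /u addrC addKr scale1r.
have vx : v - x = -1 *: delta_mx 0 i by rewrite /v addrC addKr scaleN1r.
rewrite /bregman ux vx !Gi; move: (h u z) (h v z) => b a.
have := ler_norm (b - h x z); have := ler_norm (a - h x z).
have := normr_ge0 (b - h x z); have := normr_ge0 (a - h x z).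
by rewrite ler_norml => *; apply/andP; split; lra.
Qed.

Lemma itg_bregman y x : itg m (fun z => bregman (h^~ z) y x).
Proof.
apply: itgB; first by apply: itgB.
apply: itg_sum => i _; under eq_fun do rewrite mulrC.
by apply: itgZ; exact: itg_grad.
Qed.

(** Linearity alone suffices, because [GH] is by definition the expected gradient; nothing is
    differentiated under the integral. *)
Lemma Ex_bregman y x : \int[m]_z bregman (h^~ z) y x = H y - H x - dotv (GH x) (y - x).
Proof.
have iG i : itg m (fun z => G x z 0 i * (y - x) 0 i).
  by under eq_fun do rewrite mulrC; apply: itgZ; exact: itg_grad.
rewrite ExB ?ExB//; [|exact: itgB|exact: itg_sum].
congr (_ - _); rewrite Ex_sum//; apply: eq_bigr => i _.
have e : \int[m]_z ((y - x) 0 i * G x z 0 i) = (y - x) 0 i * \int[m]_z G x z 0 i.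
  exact: ExZ (itg_grad x i).
by under eq_Rintegral do rewrite mulrC; rewrite e mulrC [in RHS]mxE.
Qed.

Lemma sample_bregman_ge0 y x : 0 <= H y - H x - dotv (GH x) (y - x).
Proof.
by rewrite -Ex_bregman; apply: Rintegral_ge0 => z _; exact: bregman_ge0 (csh z).
Qed.

Lemma sample_bregman_le y x : H y - H x - dotv (GH x) (y - x) <= L * dotv (y - x) (y - x).
Proof.
rewrite -Ex_bregman -[leRHS](Ex_cst m); apply: Ex_le.
- exact: itg_bregman.
- exact: itg_cst.
- by move=> z; exact: bregman_le.
Qed.

(** Near [x] the expectation is squeezed between its supporting affine function and that function
    plus [L] times the squared distance. *)
Lemma continuous_Ex (x : 'rV[R]_d) : H y @[y --> x] --> H x.
Proof.
have lin : H x + dotv (GH x) (y - x) @[y --> x] --> H x.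
  rewrite -[X in _ --> X]addr0 -(dotv0l (GH x)) dotvC.
  have FF := nbhs_row_filter x.
  apply: cvgD; first exact: cvg_cst.
  by apply: cvg_dotv => [i|]; [exact: cvg_cst|exact: cvg_subv].
have FF := nbhs_row_filter x.
have up : H x + dotv (GH x) (y - x) + L * dotv (y - x) (y - x) @[y --> x] --> H x.
  rewrite -[X in _ --> X]addr0 -(mulr0 L); apply: cvgD => //.
  by apply: cvgM; [exact: cvg_cst|exact: continuous_dotv_sub].
apply: (squeeze_cvgr _ lin up).
near=> y; have := sample_bregman_ge0 y x; have := sample_bregman_le y x.
by move=> ? ?; apply/andP; split; lra.
Unshelve. all: end_near.
Qed.

End Sample.

(** * Integrating out one sample *)

Section IndependentExpectation.
Context (R : realType) (dO dE : measure_display) (Omega : measurableType dO).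
Context (P : probability Omega R) (J : finType) (E : J -> measurableType dE).
Context (X : forall q, {mfun Omega >-> E q}) (m : forall q, probability (E q) R).
Hypothesis indep : mutually_independent P (fun q => X q : Omega -> E q).
Variable q : J.
Hypothesis distX : forall A, measurable A -> distribution P (X q) A = m q A.

Lemma integral_distribution_eq (u : E q -> \bar R) :
  (\int[distribution P (X q)]_z u z = \int[m q]_z u z)%E.
Proof. by apply: eq_measure_integral => A mA _; exact: distX. Qed.

Lemma itg_distribution (u : E q -> R) : itg (m q) u -> itg P (u \o X q).
Proof.
move=> iu; have mu := itg_measurable iu.
have muX : measurable_fun setT (u \o X q) by exact: measurableT_comp.
apply/integrableP; split; first exact/measurable_EFinP.
have /integrableP[_] := iu.
have mau : measurable_fun setT (fun z => `|(u z)%:E|%E).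
  by apply: measurableT_comp => //; exact/measurable_EFinP.
by rewrite -integral_distribution_eq (ge0_integral_distribution (X q)).
Qed.

Lemma Ex_distribution (u : E q -> R) : itg (m q) u ->
  \int[P]_w u (X q w) = \int[m q]_z u z.
Proof.
move=> iu; have iuX := itg_distribution iu.
have mEu : measurable_fun setT (EFin \o u) by exact/measurable_EFinP/(itg_measurable iu).
by rewrite /Rintegral -integral_distribution_eq (random_variable.integral_distribution mEu iuX).
Qed.

Lemma itg_Ex_tonelli (F : others X q * E q -> R) (G : Omega -> R) :
  measurable_fun setT F -> (forall z, 0 <= F z) ->
  (forall w, itg (m q) (fun z => F (w, z))) ->
  (forall w, \int[m q]_z F (w, z) = G w) ->
  itg P (fun w => F (w, X q w)) ->
  itg P G /\ \int[P]_w F (w, X q w) = \int[P]_w G w.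
Proof.
move=> mF F0 iF FG iFX.
have mEF : measurable_fun setT (EFin \o F) by exact/measurable_EFinP.
have EG w : (\int[m q]_z (F (w, z))%:E)%E = (G w)%:E.
  by rewrite -FG -integral_Ex.
have eqi : (\int[P]_w (F (w, X q w))%:E = \int[P]_w (G w)%:E)%E.
  rewrite (@tonelli_others _ _ _ _ _ _ _ _ q (m q) (EFin \o F) indep distX)//.
  by apply: eq_integral => w _; rewrite EG.
split; last by rewrite /Rintegral eqi.
have G0 w : 0 <= G w by rewrite -FG; apply: Rintegral_ge0.
have mG : measurable_fun setT G.
  apply: (@measurable_others _ _ _ _ _ X q).
  have := @measurable_fun_fubini_tonelli_F _ _ (others X q) (E q) R (m q) (EFin \o F) mEF.
  move=> /(_ (fun z => F0 z)) mFF; apply/measurable_EFinP.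
  suff <- : fubini_F (m q) (EFin \o F) = EFin \o G by [].
  by apply/funext => w; exact: EG.
apply/integrableP; split; first exact/measurable_EFinP.
have /integrableP[_] := iFX.
under eq_integral do rewrite /= ger0_norm//.
under [in X in _ -> X]eq_integral do rewrite /= ger0_norm//.
by rewrite eqi.
Qed.

Lemma itg_Ex_caratheodory (d : nat) (g : 'rV[R]_d -> E q -> R) (Y : Omega -> 'rV[R]_d) :
  (forall y z, 0 <= g y z) -> (forall y, itg (m q) (g y)) ->
  (forall z, continuous (g^~ z)) -> vmeas (Y : others X q -> 'rV[R]_d) ->
  itg P (fun w => g (Y w) (X q w)) ->
  itg P (fun w => \int[m q]_z g (Y w) z) /\
  \int[P]_w g (Y w) (X q w) = \int[P]_w (\int[m q]_z g (Y w) z).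
Proof.
move=> g0 ig cg mY igY.
apply: (@itg_Ex_tonelli (fun wz => g (Y wz.1) wz.2)) => //; last by move=> w; exact: (ig (Y w)).
apply: measurable_comp_caratheodory => //.
- by move=> x; exact/itg_measurable/ig.
- move=> i; exact: (measurableT_comp (mY i) measurable_fst).
Qed.

(* Tonelli's theorem only applies to nonnegative integrands, so it is applied to
   [(Y + c) ^+ 2], whose expansion isolates the product. *)
Lemma Ex_mul0 (Y : Omega -> R) (c : E q -> R) :
  measurable_fun setT (Y : others X q -> R) -> sqitg P Y -> sqitg (m q) c ->
  \int[m q]_z c z = 0 -> \int[P]_w (Y w * c (X q w)) = 0.
Proof.
move=> mY sY sc c0.
have [mc ic] := sc; have [mYO iY] := sY.
have scX : sqitg P (fun w => c (X q w)).
  by split; [exact: (measurableT_comp mc)|exact: (itg_distribution ic)].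
have iYc : itg P (fun w => Y w * c (X q w)) by exact: sqitg_mul.
have icc := sqitg_itg sc.
have : itg P (fun w => Y w ^+ 2 + \int[m q]_z c z ^+ 2) /\
    \int[P]_w (Y w + c (X q w)) ^+ 2 = \int[P]_w (Y w ^+ 2 + \int[m q]_z c z ^+ 2).
  apply: (@itg_Ex_tonelli (fun wz => (Y wz.1 + c wz.2) ^+ 2)).
  - apply: measurable_funX; apply: measurable_funD.
      exact: (measurableT_comp mY measurable_fst).
    exact: (measurableT_comp mc measurable_snd).
  - by move=> z; exact: sqr_ge0.
  - by move=> w; have [] := sqitgD (sqitg_cst (m q) (Y w)) sc.
  - move=> w /=; under eq_Rintegral do rewrite sqrrD -mulr_natl.
    rewrite ExD//; last first.
      by apply: itgD; [exact: itg_cst|do 2!apply: itgZ].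
    rewrite ExD//; [|exact: itg_cst|by do 2!apply: itgZ].
    rewrite Ex_cst ExZ ?ExZ//; last by apply: itgZ.
    by rewrite c0 !mulr0 addr0.
  - by have [] := sqitgD sY scX.
case=> _.
have [_ iX2] := scX.
rewrite ExD//; last exact: itg_cst.
under eq_Rintegral do rewrite sqrrD -mulr_natl.
rewrite ExD//; last by apply: itgD => //; exact: itgZ.
rewrite ExD//; last exact: itgZ.
rewrite ExZ// Ex_cst.
rewrite (Ex_distribution ic).
by move: (\int[P]_w _) (\int[P]_w _) (\int[m q]_w _) => a b e; lra.
Qed.

Lemma Ex_dotv0 (d : nat) (Y : Omega -> 'rV[R]_d) (c : E q -> 'rV[R]_d) :
  vmeas (Y : others X q -> 'rV[R]_d) -> vsqitg P Y -> vsqitg (m q) c ->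
  (forall i, \int[m q]_z c z 0 i = 0) -> \int[P]_w dotv (Y w) (c (X q w)) = 0.
Proof.
move=> mY sY sc c0.
have scX i : sqitg P (fun w => c (X q w) 0 i).
  have [mc ic] := sc i.
  by split; [exact: (measurableT_comp mc)|exact: (itg_distribution ic)].
rewrite Ex_sum => [|i _]; last exact: sqitg_mul.
by rewrite big1// => i _; exact: (Ex_mul0 (mY i) (sY i) (sc i) (c0 i)).
Qed.

End IndependentExpectation.

(** * The weighted recursion *)

Section Recursion.
Context (R : realType).
Variables (T E : nat) (L mu eta s a b : R) (r e v : nat -> R).
Hypothesis E0 : (0 < E)%N.
Hypothesis L0 : 0 <= L.
Hypothesis eta0 : 0 < eta.
Hypothesis mu0 : 0 <= mu.
Hypothesis etaLE : eta * (L * E%:R) <= 64^-1.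
Hypothesis etamuE : mu * eta * E%:R <= 2^-1.
Hypothesis a0 : 0 <= a.
Hypothesis b0 : 0 <= b.
Hypothesis r0 : forall t, 0 <= r t.
Hypothesis e0 : forall t, 0 <= e t.
Hypothesis v0 : forall t, 0 <= v t.
Hypothesis step : forall t, (t < T)%N -> r t.+1 <=
  r t + 2 * eta * (L * v t - e t - mu / 2 * r t)
  + eta ^+ 2 * (4 * L ^+ 2 * v t + 16 * L * e t + 2 * s).
Hypothesis drifted : forall t, (t < T)%N -> exists2 t0, (t0 <= t < t0 + E)%N &
  v t <= 3 * eta ^+ 2 * (
    (t - t0)%:R * \sum_(t0 <= i < t) (2 * L ^+ 2 * v i + 8 * L * e i)
    + (t - t0)%:R * a + (t - t0)%:R ^+ 2 * b).

Local Notation q := (1 - mu * eta).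
Local Notation w t := (q ^+ (T - t - 1)).
Local Notation W := (\sum_(t < T) w t).
(** The drift over a window, where at most [E - 1] steps follow a synchronization. In the
    application [s] is [sigma ^+ 2 / n], [a] is [(n - 1) / n * sigma ^+ 2] and [b] is
    [zeta ^+ 2]. *)
Let Delta := (E%:R - 1) * (a + (E%:R - 1) * b).
Let u i := 2 * L ^+ 2 * v i + 8 * L * e i.

Let E1 : 1 <= E%:R :> R. Proof. by rewrite ler1n. Qed.

Let q_ge : 2^-1 <= q.
Proof.
have h : mu * eta <= mu * eta * E%:R by rewrite ler_peMr ?mulr_ge0// ltW.
by have := le_trans h etamuE; lra.
Qed.

Let q0 : 0 <= q. Proof. by have := q_ge; lra. Qed.

Let q1 : q <= 1. Proof. by rewrite gerBl mulr_ge0// ltW. Qed.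

Lemma bernoulli_exp (x : R) m : 0 <= x <= 1 -> 1 - m%:R * x <= (1 - x) ^+ m.
Proof.
move=> /andP[x0 x1]; elim: m => [|m IH]; first by rewrite mul0r subr0 expr0.
rewrite exprS; apply: le_trans (_ : (1 - x) * (1 - m%:R * x) <= _); last first.
  by rewrite ler_wpM2l// subr_ge0.
have : 0 <= m%:R * (x * x) by rewrite !mulr_ge0.
by rewrite -natr1; lra.
Qed.

(** Multiplying step [t] by [w t] makes the distances telescope, since [q * w t = q ^+ (T - t)]. *)
Lemma telescoped m : (m <= T)%N ->
  q ^+ (T - m) * r m + \sum_(t < m) w t * ((2 * eta - 16 * L * eta ^+ 2) * e t) <=
  q ^+ T * r 0%N + \sum_(t < m) w t * ((2 * eta * L + 4 * eta ^+ 2 * L ^+ 2) * v t + 2 * eta ^+ 2 * s).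
Proof.
elim: m => [|m IH] mT; first by rewrite !big_ord0 subn0 !addr0.
rewrite !big_ord_recr/=.
have {}IH := IH (ltnW mT).
have wm : (T - m)%N = (T - m.+1).+1 by rewrite -subSn.
have wE : (T - m - 1)%N = (T - m.+1)%N by rewrite -subnDA addn1.
have h : q ^+ (T - m.+1) * r m.+1 <= q ^+ (T - m.+1) * (q * r m
    - (2 * eta - 16 * L * eta ^+ 2) * e m
    + ((2 * eta * L + 4 * eta ^+ 2 * L ^+ 2) * v m + 2 * eta ^+ 2 * s)).
  rewrite ler_wpM2l ?exprn_ge0//; apply: le_trans (step mT) _.
  by rewrite le_eqVlt; apply/orP; left; apply/eqP; field.
by move: IH h; rewrite wE wm exprSr; lra.
Qed.

(** Here [w t * q ^+ (t - i) = w i], and Bernoulli's inequality gives [q ^+ (t - i) >= 1 - mu * eta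
    * E >= 1 / 2]. *)
Lemma weight_window i t : (i < t < i + E)%N -> (t < T)%N -> w t <= 2 * w i.
Proof.
move=> /andP[it tiE] tT.
have -> : (T - i - 1 = (T - t - 1) + (t - i))%N.
  by move: it tT; clear; lia.
rewrite exprD mulrCA -[leLHS]mulr1 ler_wpM2l ?exprn_ge0//.
have := bernoulli_exp (t - i) (_ : 0 <= mu * eta <= 1).
have tE : (t - i)%:R * (mu * eta) <= 2^-1.
  have me0 : 0 <= mu * eta by rewrite mulr_ge0// ltW.
  apply: le_trans etamuE; rewrite [leLHS]mulrC; apply: ler_wpM2l => //.
  by rewrite ler_nat leq_subLR ltnW.
have -> : 0 <= mu * eta <= 1 by apply/andP; split; [rewrite mulr_ge0// ltW|rewrite -subr_ge0].
by move=> /(_ isT); lra.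
Qed.

Lemma window_sum_le (F : nat -> R) i : (forall t, 0 <= F t) ->
  \sum_(t < T | (i < t < i + E)%N) F t <= \sum_(i.+1 <= t < i + E) F t.
Proof.
move=> F0; rewrite -(big_mkord (fun t => (i < t < i + E)%N)).
rewrite [leLHS](big_nat_widen _ _ (T + (i + E))) ?leq_addr//.
rewrite [leRHS](big_nat_widen _ _ (T + (i + E))) ?leq_addl// [leRHS](big_nat_widenl _ 0)//.
rewrite [leLHS]big_mkcond [leRHS]big_mkcond; apply: ler_sum => t _.
by case: ifP => [/andP[/andP[-> ->] _]//|_]; case: ifP.
Qed.

(** After exchanging the sums, each [u i] is charged by at most [E - 1] later times, with weights at
    most [2 * w i]. *)
Lemma weighted_window : \sum_(t < T) w t * \sum_(i < T | (i < t < i + E)%N) u i <=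
  2 * (E%:R - 1) * \sum_(i < T) w i * u i.
Proof.
have u0 i : 0 <= u i by rewrite addr_ge0// !mulr_ge0 ?sqr_ge0.
under eq_bigr do rewrite mulr_sumr.
rewrite (exchange_big_dep xpredT)//= mulr_sumr; apply: ler_sum => i _.
rewrite -mulr_suml mulrA ler_wpM2r//.
apply: (@le_trans _ _ (\sum_(t < T | (i < t < i + E)%N) 2 * w i)).
  by apply: ler_sum => t /weight_window; apply.
apply: le_trans (@window_sum_le (fun=> 2 * w i) i _) _ => [_|].
  by rewrite mulr_ge0 ?exprn_ge0.
rewrite sumr_const_nat -(mulr_natl (2 * w i)) mulrA (mulrC 2).
rewrite ler_wpM2r ?exprn_ge0// ler_wpM2r//.
by rewrite lerBrDr natr1 ler_nat subnS addKn prednK.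
Qed.

(** The unknown start [t0] is traded for the condition [i < t < i + E], which allows the sums over
    [i] and [t] to be exchanged. *)
Lemma spread_window t : (t < T)%N -> v t <= 3 * eta ^+ 2 * (
  (E%:R - 1) * \sum_(i < T | (i < t < i + E)%N) u i + Delta).
Proof.
move=> tT; have [t0 /andP[t0t tE] vt] := drifted tT.
apply: le_trans vt _; apply: ler_wpM2l; first by rewrite mulr_ge0 ?sqr_ge0.
rewrite -addrA.
have tau : (t - t0)%:R <= E%:R - 1 :> R.
  by rewrite lerBrDr natr1 ler_nat ltn_subLR.
have u0 i : 0 <= u i by rewrite addr_ge0// !mulr_ge0 ?sqr_ge0.
apply: lerD.
  apply: ler_pM => //; first by apply: sumr_ge0 => i _; exact: u0.
  rewrite (big_nat_widen _ _ _ _ _ (ltnW tT)) big_geq_mkord/=.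
  rewrite [leLHS]big_mkcond [leRHS]big_mkcond; apply: ler_sum => i _.
  case: ifPn => [/andP[it ti]|_]; last by case: ifP.
  by rewrite it (leq_trans tE)// leq_add2r.
rewrite expr2 -mulrA -mulrDr /Delta; apply: ler_pM => //.
  by rewrite addr_ge0// mulr_ge0.
by rewrite lerD2l ler_wpM2r.
Qed.

Lemma weighted_recursion : eta * \sum_(t < T) w t * e t <=
  q ^+ T * r 0%N + (18 * eta ^+ 3 * L * Delta + 2 * eta ^+ 2 * s) * W.
Proof.
have Delta0 : 0 <= Delta by rewrite mulr_ge0 ?subr_ge0// addr_ge0// mulr_ge0// subr_ge0.
set Se := \sum_(t < T) w t * e t.
pose Sv := \sum_(t < T) w t * v t.
have w0 t : 0 <= w t by rewrite exprn_ge0.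
have Se0 : 0 <= Se by apply: sumr_ge0 => t _; rewrite mulr_ge0.
have Sv0 : 0 <= Sv by apply: sumr_ge0 => t _; rewrite mulr_ge0.
have W0 : 0 <= W by apply: sumr_ge0.
(* Summing the drift bound over time controls the total spread by itself and by the total
   suboptimality. *)
have hv : Sv <= 3 * eta ^+ 2 * ((E%:R - 1) * (2 * (E%:R - 1) * (2 * L ^+ 2 * Sv + 8 * L * Se)) + Delta * W).
  apply: (@le_trans _ _ (\sum_(t < T) (3 * eta ^+ 2 * (E%:R - 1) * (w t * \sum_(i < T | (i < t < i + E)%N) u i)
      + 3 * eta ^+ 2 * Delta * w t))).
    apply: ler_sum => t _; have := ler_wpM2l (w0 t) (spread_window (ltn_ord t)).
    move/le_trans; apply; rewrite le_eqVlt; apply/orP; left; apply/eqP; ring.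
  rewrite big_split/= -!mulr_sumr.
  have eu : \sum_(i < T) w i * u i = 2 * L ^+ 2 * Sv + 8 * L * Se.
    rewrite /Sv /Se !mulr_sumr -big_split/=; apply: eq_bigr => i _; rewrite /u; ring.
  have c0 : 0 <= 3 * eta ^+ 2 * (E%:R - 1) by rewrite mulr_ge0 ?subr_ge0// mulr_ge0// sqr_ge0.
  have := ler_wpM2l c0 weighted_window; rewrite eu; lra.
have tel : (2 * eta - 16 * L * eta ^+ 2) * Se <=
    q ^+ T * r 0%N + ((2 * eta * L + 4 * eta ^+ 2 * L ^+ 2) * Sv + 2 * eta ^+ 2 * s * W).
  have := telescoped (leqnn T); rewrite subnn expr0 mul1r.
  under eq_bigr do rewrite mulrCA.
  under [X in _ <= _ + X]eq_bigr do rewrite mulrDr mulrCA [X in _ + X]mulrC.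
  rewrite big_split/= -!mulr_sumr -/Se -/Sv; have := r0 T; lra.
(* The step-size condition makes both [x] and [x * F] at most 1/64; all absorptions below rest on
   this. *)
pose x := eta * L; pose F : R := E%:R - 1.
have x0 : 0 <= x by rewrite mulr_ge0// ltW.
have F0 : 0 <= F by rewrite subr_ge0.
have xF : x * F <= 64^-1.
  apply: le_trans etaLE; rewrite mulrA ler_wpM2l// /F; lra.
have x1 : x <= 64^-1.
  by apply: le_trans etaLE; rewrite mulrA ler_peMr.
have xF2 : x ^+ 2 * F ^+ 2 <= 64^-1 ^+ 2.
  by rewrite -exprMn !expr2; apply: ler_pM => //; exact: mulr_ge0.
(* The coefficient of [Sv] on the right is at most 12/4096, below 1/2. Absorbing [Sv / 2] on the
   left doubles the other terms. *)
have hv2 : Sv <= 96 * (x * eta * F ^+ 2) * Se + 6 * eta ^+ 2 * Delta * W.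
  have e1 : 3 * eta ^+ 2 * (F * (2 * F * (2 * L ^+ 2 * Sv + 8 * L * Se)) + Delta * W) =
    12 * (x ^+ 2 * F ^+ 2) * Sv + 48 * (x * eta * F ^+ 2) * Se + 3 * eta ^+ 2 * Delta * W.
    by rewrite /x; ring.
  have : 12 * (x ^+ 2 * F ^+ 2) * Sv <= 2^-1 * Sv.
    by rewrite ler_wpM2r//; lra.
  by move: hv; rewrite -/F e1; lra.
have h5 : 0 <= eta * Se by rewrite mulr_ge0// ltW.
have hx : (2 * eta * L + 4 * eta ^+ 2 * L ^+ 2) * Sv <= 3 * x * Sv.
  rewrite ler_wpM2r//; have -> : 2 * eta * L + 4 * eta ^+ 2 * L ^+ 2 = 2 * x + 4 * (x * x).
    by rewrite /x; ring.
  have : x * x <= 64^-1 * x by rewrite ler_wpM2r.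
  by lra.
have h3 : 3 * x * Sv <= 2^-1 * eta * Se + 18 * eta ^+ 3 * L * Delta * W.
  apply: (@le_trans _ _ (3 * x * (96 * (x * eta * F ^+ 2) * Se + 6 * eta ^+ 2 * Delta * W))).
    by rewrite ler_wpM2l// mulr_ge0.
  have -> : 3 * x * (96 * (x * eta * F ^+ 2) * Se + 6 * eta ^+ 2 * Delta * W) =
     288 * (x ^+ 2 * F ^+ 2) * (eta * Se) + 18 * eta ^+ 3 * L * Delta * W by rewrite /x; ring.
  by rewrite lerD2r -(mulrA 2^-1); apply: ler_wpM2r => //; lra.
(* Of the [2 * eta * Se] in [tel], this term takes a quarter of [eta * Se] and [h3] a half, which
   leaves more than [eta * Se]. *)
have h4 : 16 * L * eta ^+ 2 * Se <= 4^-1 * (eta * Se).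
  have -> : 16 * L * eta ^+ 2 * Se = 16 * x * (eta * Se) by rewrite /x; ring.
  by apply: ler_wpM2r => //; lra.
by lra.
Qed.

End Recursion.

(** Take for [t0] the last element of [I], 0 and [T] that is not after [t]. Its successor in sorted
    order lies after [t], at distance at most the gap. *)
Lemma gap_window (T : nat) (I : seq nat) (t : nat) : (t < T)%N ->
  exists t0, [/\ (t0 <= t < t0 + gap T I)%N, t0 = 0%N \/ t0 \in I &
    forall s, (t0 < s <= t)%N -> s \notin I].
Proof.
move=> tT.
pose A := [:: 0%N, T & I].
have [t0 /andP[t0A t0t] t0max] := @ex_maxnP (fun m => (m \in A) && (m <= t)%N) t
  (ex_intro _ 0%N isT) (fun m => fun h => proj2 (andP h)).
pose s := sort leq (undup A).
have ms m : (m \in s) = (m \in A) by rewrite mem_sort mem_undup.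
have ss : sorted ltn s.
  rewrite ltn_sorted_uniq_leq sort_uniq undup_uniq sort_sorted//; exact: leq_total.
exists t0; split.
- rewrite t0t /=.
  pose i := index t0 s.
  have is_ : (i < size s)%N by rewrite index_mem ms.
  have ti : nth 0%N s i = t0 by rewrite nth_index// ms.
  pose j := index T s.
  have js : (j < size s)%N by rewrite index_mem ms !inE eqxx orbT.
  have tj : nth 0%N s j = T by rewrite nth_index// ms !inE eqxx orbT.
  (* A successor of [t0] exists because [T] is listed and exceeds [t0]. *)
  have ij : (i < j)%N.
    rewrite ltnNge; apply/negP => ji.
    have := @sorted_leq_nth _ leq leq_trans leqnn 0%N s (sub_sorted ltnW ss) j i js is_ ji.
    rewrite ti tj => Tt0.
    by move: tT; rewrite ltnNge (leq_trans Tt0).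
  have i1s : (i.+1 < size s)%N by exact: leq_ltn_trans js.
  have i1 : (i < (size s).-1)%N by rewrite ltn_predRL.
  have tn : (t < nth 0%N s i.+1)%N.
    rewrite ltnNge; apply/negP => nt.
    have := t0max (nth 0%N s i.+1); rewrite nt andbT -ms mem_nth// => /(_ isT).
    have := @sorted_ltn_nth _ ltn ltn_trans 0%N s ss i i.+1 is_ i1s (ltnSn i).
    rewrite ti => h1 h2.
    by move: h1; rewrite /= ltnNge h2.
  apply: leq_trans tn _; rewrite -leq_subLR.
  have := leq_bigmax (F := fun i : 'I_(size s).-1 => (nth 0 s i.+1 - nth 0 s i)%N) (Ordinal i1).
  by rewrite /= ti.
- by move: t0A; rewrite !inE => /or3P[/eqP|/eqP t0T|]; [left| |right] => //; move: tT; rewrite ltnNge -t0T t0t.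
- move=> r /andP[t0r rt]; apply/negP => rI.
  have := t0max r; rewrite rt !inE rI !orbT => /(_ isT).
  by rewrite leqNgt t0r.
Qed.

(** * Tuning the learning rate *)

Section Tuning.
Context (R : realType).
Implicit Types (n T E : nat) (L mu B sigma zeta eta : R).

(** The bound of [weighted_recursion] divided by [eta] times the weight sum: bias, drift and noise
    as functions of the learning rate. *)
Definition error_bound (n T E : nat) (L mu B sigma zeta eta : R) : R :=
  let q := 1 - mu * eta in
  q ^+ T * B ^+ 2 / (eta * \sum_(t < T) q ^+ (T - t - 1))
  + 18 * eta ^+ 2 * (L * ((E%:R - 1) * drift n E sigma zeta))
  + 2 * eta * (sigma ^+ 2 / n%:R).

Lemma drift_ge0 n E sigma zeta : (0 < n)%N -> 0 <= drift n E sigma zeta.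
Proof.
move=> n0; rewrite /drift addr_ge0// mulr_ge0 ?sqr_ge0//.
by rewrite divr_ge0// subr_ge0 ler1n.
Qed.

Lemma stochastic_terms_ge0 n T E L mu sigma zeta : (0 < n)%N -> (0 < E)%N ->
  0 <= L -> 0 <= mu -> 0 <= stochastic_terms n T E L mu sigma zeta.
Proof.
move=> n0 E0 L0 mu0; have d0 := drift_ge0 E sigma zeta n0.
rewrite /stochastic_terms addr_ge0// ?divr_ge0 ?sqr_ge0 ?mulr_ge0//.
  by rewrite subr_ge0 ler1n.
by rewrite invr_ge0 mulr_ge0 ?sqr_ge0.
Qed.

Lemma tuned_convex n T E L B sigma zeta : (0 < n)%N -> (0 < T)%N -> (0 < E)%N ->
  0 < L -> 0 < B -> 0 <= sigma -> exists eta,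
  [/\ 0 < eta, eta * (L * E%:R) <= 64^-1 &
    error_bound n T E L 0 B sigma zeta eta <= 64 * convex_rate n T E L B sigma zeta].
Proof.
move=> n0 T0 E0 L0 B0 s0.
have n1 : 0 < n%:R :> R by rewrite ltr0n.
have T1 : 0 < T%:R :> R by rewrite ltr0n.
have E1 : 0 < E%:R :> R by rewrite ltr0n.
have dr := drift_ge0 E sigma zeta n0.
have A0 : 0 <= (E%:R - 1) * L * B ^+ 4.
  by rewrite !mulr_ge0 ?exprn_ge0 ?subr_ge0 ?ler1n// ltW.
pose x := L * E%:R * B ^+ 2 / T%:R.
pose s := B * sigma / Num.sqrt (n%:R * T%:R).
pose y := ((E%:R - 1) * L * B ^+ 4) `^ (3^-1) / T%:R `^ (2 / 3) * drift n E sigma zeta `^ (3^-1).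
have x0 : 0 < x by rewrite divr_gt0// !mulr_gt0// exprn_gt0.
have ss0 : 0 <= s by rewrite divr_ge0 ?mulr_ge0 ?sqrtr_ge0// ltW.
have y0 : 0 <= y by rewrite !mulr_ge0 ?invr_ge0 ?powR_ge0.
have cube (z : R) : 0 <= z -> (z `^ 3^-1) ^+ 3 = z.
  by move=> z0; rewrite -powR_mulrn ?powR_ge0// -powRrM mulVf// powRr1.
have y3 : y ^+ 3 = L * ((E%:R - 1) * drift n E sigma zeta) * B ^+ 4 / T%:R ^+ 2.
  rewrite /y !exprMn exprVn !cube//.
  have -> : (T%:R `^ (2 / 3)) ^+ 3 = T%:R ^+ 2 :> R.
    by rewrite -powR_mulrn ?powR_ge0// -powRrM divfK// powR_mulrn// ltW.
  by rewrite mulrAC; congr (_ / _); ring.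
have s2 : s ^+ 2 = B ^+ 2 * sigma ^+ 2 / (n%:R * T%:R).
  by rewrite /s exprMn exprMn exprVn sqr_sqrtr// mulr_ge0// ltW.
(* With [eta := B ^+ 2 / (T * k)] the initial error is [k], the drift error is at
   most [18 * y ^+ 3 / k ^+ 2] and the noise error at most [2 * s ^+ 2 / k]. *)
pose k := 64 * x + s + y.
have k0 : 0 < k by rewrite /k; lra.
pose eta := B ^+ 2 / (T%:R * k).
have eta0 : 0 < eta by rewrite divr_gt0 ?exprn_gt0// mulr_gt0.
have B2 : 0 < B ^+ 2 by rewrite exprn_gt0.
have Bn : B != 0 by rewrite gt_eqF.
have Tn : T%:R != 0 :> R by rewrite gt_eqF.
have nn : n%:R != 0 :> R by rewrite gt_eqF.
have kn : k != 0 by rewrite gt_eqF.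
exists eta; split=> //.
  (* The summand [64 * x] of [k] is there to enforce the step-size condition. *)
  have -> : eta * (L * E%:R) = x / k by rewrite /eta /x; field; rewrite kn.
  by rewrite ler_pdivrMr// /k; lra.
rewrite /error_bound /convex_rate -/x -/s -/y mul0r subr0 expr1n.
under eq_bigr do rewrite expr1n.
rewrite sumr_const card_ord.
have -> : 1 * B ^+ 2 / (eta * T%:R) = k by rewrite /eta; field; rewrite kn Tn Bn.
have yk : y <= k by rewrite /k; lra.
have sk : s <= k by rewrite /k; lra.
have h1 : eta ^+ 2 * (L * ((E%:R - 1) * drift n E sigma zeta)) <= y.
  have -> : eta ^+ 2 * (L * ((E%:R - 1) * drift n E sigma zeta)) = y ^+ 3 / k ^+ 2.
    by rewrite y3 /eta; field; rewrite kn Tn.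
  rewrite ler_pdivrMr ?exprn_gt0// exprS ler_wpM2l// lerXn2r// ?nnegrE//.
  exact: ltW.
have h2 : eta * (sigma ^+ 2 / n%:R) <= s.
  have -> : eta * (sigma ^+ 2 / n%:R) = s ^+ 2 / k.
    by rewrite s2 /eta; field; rewrite kn Tn.
  by rewrite ler_pdivrMr// expr2 ler_wpM2l.
(* The total is at most [64 * x + 3 * s + 19 * y]. *)
rewrite /k; lra.
Qed.

Lemma weight_sum_ge1 T (q : R) : (0 < T)%N -> 0 <= q ->
  1 <= \sum_(t < T) q ^+ (T - t - 1).
Proof.
case: T => // T _ q0; rewrite big_ord_recr/= subSn// subnn subnn expr0.
by rewrite lerDr sumr_ge0// => t _; exact: exprn_ge0.
Qed.

(** With [l = eta * mu * T], the drift is [18 * l ^+ 2] times its share of [stochastic_terms] and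
    the noise [2 * l] times its share. Both are covered by [Lam ^+ 2], as [l <= Lam] and [1 <= Lam].
    If the stochastic terms vanish, so do both. *)
Lemma noise_terms_le n T E L mu sigma zeta eta Lam :
  (0 < n)%N -> (0 < T)%N -> (0 < E)%N -> 0 <= L -> 0 < mu -> 0 <= eta ->
  1 <= Lam -> eta * (mu * T%:R) <= Lam \/ stochastic_terms n T E L mu sigma zeta = 0 ->
  18 * eta ^+ 2 * (L * ((E%:R - 1) * drift n E sigma zeta)) + 2 * eta * (sigma ^+ 2 / n%:R)
  <= 18 * Lam ^+ 2 * stochastic_terms n T E L mu sigma zeta.
Proof.
move=> n0 T0 E0 L0 mu0 eta_ge Lam1 small.
have dr := drift_ge0 E sigma zeta n0.
have n1 : 0 < n%:R :> R by rewrite ltr0n.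
have T1 : 0 < T%:R :> R by rewrite ltr0n.
rewrite /stochastic_terms in small *.
set a := sigma ^+ 2 / (n%:R * mu * T%:R) in small *.
set b := (E%:R - 1) * L / (mu ^+ 2 * T%:R ^+ 2) * drift n E sigma zeta in small *.
have a0 : 0 <= a by rewrite divr_ge0 ?sqr_ge0 ?mulr_ge0// ltW.
have b0 : 0 <= b.
  rewrite mulr_ge0// divr_ge0//; first by rewrite mulr_ge0 ?subr_ge0 ?ler1n.
  by rewrite mulr_ge0 ?sqr_ge0.
have -> : 18 * eta ^+ 2 * (L * ((E%:R - 1) * drift n E sigma zeta)) =
    18 * ((eta * (mu * T%:R)) ^+ 2 * b) by rewrite /b; field; rewrite !gt_eqF.
have -> : 2 * eta * (sigma ^+ 2 / n%:R) = 2 * (eta * (mu * T%:R) * a).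
  by rewrite /a; field; rewrite !gt_eqF.
case: small => [le|ab0]; last first.
  have [/eqP-> /eqP->] : a == 0 /\ b == 0.
    by apply/andP; rewrite -paddr_eq0// ab0.
  by rewrite !mulr0 !addr0 mulr0.
have e0 : 0 <= eta * (mu * T%:R) by rewrite !mulr_ge0// ltW.
clearbody a b; clear dr n1 T1 eta_ge mu0 L0.
have : (eta * (mu * T%:R)) ^+ 2 * b <= Lam ^+ 2 * b.
  by rewrite ler_wpM2r// lerXn2r// nnegrE// (le_trans e0).
have : eta * (mu * T%:R) * a <= Lam ^+ 2 * a.
  by rewrite ler_wpM2r// (le_trans le)// expr2 ler_peMl// (le_trans ler01).
have : 0 <= Lam ^+ 2 * a by rewrite mulr_ge0 ?sqr_ge0.
by lra.
Qed.

Lemma exprn_le_expR m (x : R) : x <= 1 -> (1 - x) ^+ m <= expR (- (m%:R * x)).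
Proof.
move=> x1; rewrite -mulrN expRM_natl lerXn2r ?nnegrE ?subr_ge0 ?expR_ge0//.
exact: expR_ge1Dx.
Qed.

(** Used for the largest admissible rate: the weight sum is at least its last term 1, and [1 / eta]
    is at most [K]. *)
Lemma bias_le_exp T (K mu B eta : R) : (0 < T)%N -> 0 < K -> 0 < mu -> 0 < eta ->
  mu * eta <= 1 -> K^-1 <= eta ->
  (1 - mu * eta) ^+ T * B ^+ 2 / (eta * \sum_(t < T) (1 - mu * eta) ^+ (T - t - 1)) <=
  K * B ^+ 2 * expR (- (mu * T%:R / K)).
Proof.
move=> T0 K0 mu0 eta0 me Keta; set q := 1 - mu * eta; set W := \sum_(t < T) _.
have q0 : 0 <= q by rewrite subr_ge0.
have W1 : 1 <= W by exact: weight_sum_ge1.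
have eW : 0 < eta * W by rewrite mulr_gt0// (lt_le_trans ltr01).
have -> : q ^+ T * B ^+ 2 / (eta * W) = (eta * W)^-1 * B ^+ 2 * q ^+ T.
  by rewrite mulrC mulrCA mulrC.
rewrite ler_pM ?exprn_ge0//.
- by rewrite mulr_ge0 ?sqr_ge0// invr_ge0 ltW.
- rewrite ler_wpM2r ?sqr_ge0// -[leRHS]invrK lef_pV2 ?posrE ?invr_gt0//.
  by rewrite (le_trans Keta)// ler_peMr// ltW.
- apply: le_trans (exprn_le_expR _ me) _.
  by rewrite ler_expR lerN2 mulrCA mulrA ler_wpM2l// mulr_ge0// ltW.
Qed.

Lemma weight_sumE T (mu eta : R) :
  mu * eta * \sum_(t < T) (1 - mu * eta) ^+ (T - t - 1) = 1 - (1 - mu * eta) ^+ T.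
Proof.
have -> : \sum_(t < T) (1 - mu * eta) ^+ (T - t - 1) =
    \sum_(t < T) (1 - mu * eta) ^+ (T.-1 - t) * 1 ^+ t.
  apply: eq_bigr => t _.
  by rewrite expr1n mulr1 -subnDA addnC subnDA subn1.
have := subrXX (1 - mu * eta) 1 T; rewrite expr1n.
by move: (\sum_(t < T) _) => W; lra.
Qed.

(** Both summands of [Lam] matter. The logarithm gives [mu * B ^+ 2 * expR (- Lam) <= S]; the 1
    gives [q ^+ T <= 1 / 2], so that the denominator [1 - q ^+ T] left by the geometric sum costs a
    factor 2. *)
Lemma bias_le_noise T (mu B S : R) : (0 < T)%N -> 0 < mu -> 0 < S ->
  let Lam := 1 + ln (1 + mu * B ^+ 2 / S) in
  let eta := Lam / (mu * T%:R) in mu * eta <= 1 ->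
  (1 - mu * eta) ^+ T * B ^+ 2 / (eta * \sum_(t < T) (1 - mu * eta) ^+ (T - t - 1)) <= 2 * S.
Proof.
move=> T0 mu0 S0 Lam eta me.
have T1 : 0 < T%:R :> R by rewrite ltr0n.
have mB : 0 <= mu * B ^+ 2 by rewrite mulr_ge0 ?sqr_ge0// ltW.
have x0 : 0 <= mu * B ^+ 2 / S by rewrite divr_ge0// ltW.
have Lam1 : 1 <= Lam by rewrite lerDl ln_ge0// lerDl.
have eta0 : 0 < eta by rewrite divr_gt0 ?mulr_gt0// (lt_le_trans ltr01).
set q : R := 1 - mu * eta; set W : R := \sum_(t < T) _.
have q0 : 0 <= q by rewrite subr_ge0.
have qL : q ^+ T <= expR (- Lam).
  apply: le_trans (exprn_le_expR _ me) _; rewrite ler_expR lerN2 /eta.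
  by rewrite le_eqVlt; apply/orP; left; apply/eqP; field; rewrite !gt_eqF.
have eL : expR (- Lam) <= 2^-1.
  rewrite expRN lef_pV2 ?posrE ?expR_gt0//.
  by apply: le_trans (expR_ge1Dx _); rewrite lerD2l.
have eS : mu * B ^+ 2 * expR (- Lam) <= S.
  have -> : expR (- Lam) = expR (- 1) * (1 + mu * B ^+ 2 / S)^-1.
    by rewrite opprD expRD (expRN (ln _)) lnK// posrE ltr_wpDr.
  rewrite mulrCA -[leRHS]mul1r ler_pM ?expR_ge0//.
  - by rewrite divr_ge0// addr_ge0.
  - rewrite ler_pdivrMr ?ltr_wpDr// [leRHS]mulrC mulrDl mul1r divfK ?gt_eqF//.
    by rewrite lerDr ltW.
have -> : q ^+ T * B ^+ 2 / (eta * W) = mu * B ^+ 2 * q ^+ T / (1 - q ^+ T).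
  have W0 : W != 0 by rewrite gt_eqF// (lt_le_trans ltr01)// weight_sum_ge1.
  rewrite -weight_sumE -/W; move: (q ^+ T) => z; field.
  by rewrite W0 !gt_eqF.
have q1 : 2^-1 <= 1 - q ^+ T by rewrite lerBrDr; have := le_trans qL eL; lra.
rewrite ler_pdivrMr ?(lt_le_trans _ q1)//.
apply: (@le_trans _ _ S); last first.
  by rewrite mulrAC ler_peMl ?(ltW S0)//; move: q1; lra.
by apply: le_trans eS; rewrite ler_wpM2l.
Qed.

Lemma tuned_strongly_convex n T E L mu B sigma zeta :
  (0 < n)%N -> (0 < T)%N -> (0 < E)%N -> 0 < mu -> mu <= 2 * L -> exists eta,
  [/\ 0 < eta, eta * (mu + L * E%:R) <= 64^-1 &
    error_bound n T E L mu B sigma zeta eta <=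
    256 * log_factor n T E L mu B sigma zeta ^+ 2
    * strongly_convex_rate n T E L mu B sigma zeta 192^-1].
Proof.
move=> n0 T0 E0 mu0 muL.
have E1 : 1 <= E%:R :> R by rewrite ler1n.
have L0 : 0 < L by lra.
have LE0 : 0 < L * E%:R by rewrite mulr_gt0// ltr0n.
have L_le : L <= L * E%:R by rewrite ler_peMr// ltW.
have S0 := stochastic_terms_ge0 T sigma zeta n0 E0 (ltW L0) (ltW mu0).
have noise := noise_terms_le n0 T0 E0 (ltW L0) mu0.
(* One bound for both cases below: the bias is at most [192 * x] or [2 * s], the noise at most
   [18 * l * s] with [l = Lam ^+ 2]. *)
have combine (l x s : R) : 1 <= l -> 0 <= x -> 0 <= s ->
    192 * x + (2 * s + 18 * l * s) <= 256 * l * (x + s).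
  move=> l1 x0 s0.
  have : x <= l * x by rewrite ler_peMl.
  have : s <= l * s by rewrite ler_peMl.
  lra.
rewrite /error_bound /strongly_convex_rate.
set Lam := log_factor _ _ _ _ _ _ _ _; set X := L * E%:R * B ^+ 2 * expR _.
have Lam1 : 1 <= Lam.
  rewrite /Lam /log_factor lerDl ln_ge0// lerDl divr_ge0// mulr_ge0 ?sqr_ge0//.
  exact: ltW.
have Lsq : 1 <= Lam ^+ 2 by rewrite expr2 mulr_ege1.
have X0 : 0 <= X by rewrite mulr_ge0 ?expR_ge0// mulr_ge0 ?sqr_ge0// ltW.
pose eta0 := (64 * (mu + L * E%:R))^-1.
have m0 : 0 < mu + L * E%:R by rewrite addr_gt0.
have eta00 : 0 < eta0 by rewrite invr_gt0 mulr_gt0.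
have eta0m : eta0 * (mu + L * E%:R) = 64^-1 by rewrite /eta0; field; rewrite gt_eqF.
have mueta eta : 0 <= eta -> eta <= eta0 -> mu * eta <= 1.
  move=> eta_ge le; apply: (@le_trans _ _ 64^-1); last by lra.
  rewrite -eta0m mulrC; apply: ler_pM => //; first exact: ltW.
  by rewrite lerDl ltW.
(* The largest admissible rate is kept if it is at most [Lam / (mu * T)] or if there is no
   stochastic error. *)
have [small|] := boolP ((eta0 * (mu * T%:R) <= Lam)
    || (stochastic_terms n T E L mu sigma zeta == 0)).
  exists eta0; split=> //; first by rewrite eta0m.
  have small' : eta0 * (mu * T%:R) <= Lam \/ stochastic_terms n T E L mu sigma zeta = 0.
    by case/orP: small => [|/eqP]; [left|right].
  have noise0 := noise sigma zeta _ _ (ltW eta00) Lam1 small'.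
  have := @bias_le_exp T (192 * (L * E%:R)) mu B eta0 T0 _ mu0 eta00 (mueta _ (ltW eta00) (lexx _)).
  have -> : 192 * (L * E%:R) * B ^+ 2 * expR (- (mu * T%:R / (192 * (L * E%:R)))) = 192 * X.
    rewrite /X !mulrA; congr (_ * expR (- _)).
    by field; rewrite ?gt_eqF// ltr0n.
  have K0 : 0 < 192 * (L * E%:R) by rewrite mulr_gt0.
  rewrite K0 lef_pV2 ?posrE ?K0 ?mulr_gt0// => /(_ isT).
  (* As [mu <= 2 * L] and [1 <= E], [mu + L * E <= 3 * (L * E)]; hence 192. *)
  have muLE : 64 * (mu + L * E%:R) <= 192 * (L * E%:R) by clear -muL L_le; lra.
  move=> /(_ muLE) bias.
  rewrite -[leLHS]addrA; apply: le_trans (lerD bias noise0) _.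
  by apply: le_trans (combine _ _ _ Lsq X0 S0); rewrite lerD2l lerDr mulr_ge0.
rewrite negb_or -ltNge => /andP[big Sn].
have Sp : 0 < stochastic_terms n T E L mu sigma zeta by rewrite lt_def Sn.
have muT0 : 0 < mu * T%:R by rewrite mulr_gt0// ltr0n.
pose eta := Lam / (mu * T%:R).
have eta_gt : 0 < eta by rewrite divr_gt0// (lt_le_trans ltr01).
have le : eta <= eta0 by rewrite /eta ler_pdivrMr// ltW.
exists eta; split=> //.
  by rewrite -eta0m ler_wpM2r// ltW.
have bias := bias_le_noise T0 mu0 Sp (mueta _ (ltW eta_gt) le).
have noise1 := noise sigma zeta eta _ (ltW eta_gt) Lam1.
have etaL : eta * (mu * T%:R) <= Lam by rewrite divfK// gt_eqF.
rewrite -[leLHS]addrA; apply: le_trans (lerD bias (noise1 (or_introl etaL))) _.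
by apply: le_trans (combine _ _ _ Lsq X0 S0); rewrite lerDr mulr_ge0.
Qed.

End Tuning.

(** * Averages over the machines *)

Section Average.
Context (R : realType) (n : nat).
Hypothesis n0 : (0 < n)%N.

Definition avg (F : 'I_n -> R) : R := n%:R^-1 * \sum_(k < n) F k.

Definition avgv (d : nat) (F : 'I_n -> 'rV[R]_d) : 'rV[R]_d := n%:R^-1 *: \sum_(k < n) F k.

Lemma natn_neq0 : n%:R != 0 :> R.
Proof. by rewrite pnatr_eq0 -lt0n. Qed.

Lemma natn_gt0 : 0 < n%:R :> R.
Proof. by rewrite ltr0n. Qed.

Lemma ler_avg (F G : 'I_n -> R) : (forall k, F k <= G k) -> avg F <= avg G.
Proof. by move=> FG; rewrite ler_wpM2l ?invr_ge0//; exact: ler_sum. Qed.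

Lemma avg_cst (a : R) : avg (fun=> a) = a.
Proof. by rewrite /avg sumr_const card_ord -[a *+ n]mulr_natl mulrA mulVf ?mul1r// natn_neq0. Qed.

Lemma avgD (F G : 'I_n -> R) : avg (fun k => F k + G k) = avg F + avg G.
Proof. by rewrite /avg big_split mulrDr. Qed.

Lemma avgZ a (F : 'I_n -> R) : avg (fun k => a * F k) = a * avg F.
Proof. by rewrite /avg -mulr_sumr mulrCA. Qed.

Lemma avgv_cst (d : nat) (u : 'rV[R]_d) : avgv (fun=> u) = u.
Proof.
apply/rowP => i; rewrite mxE summxE sumr_const card_ord.
by rewrite -(mulr_natl (u 0 i)) mulrA mulVf ?mul1r// natn_neq0.
Qed.

Lemma dotv_avg_le (d : nat) (F : 'I_n -> 'rV[R]_d) :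
  dotv (avgv F) (avgv F) <= avg (fun k => dotv (F k) (F k)).
Proof.
rewrite /avg /avgv !(dotvZl, dotvZr) mulrA -expr2 exprVn ler_pdivrMl ?exprn_gt0 ?natn_gt0//.
rewrite expr2 -mulrA mulVKf ?natn_neq0//.
by have := dotv_sum_le F; rewrite card_ord.
Qed.

Lemma dotv_avg_center (d : nat) (F : 'I_n -> 'rV[R]_d) :
  avg (fun k => dotv (F k - avgv F) (F k - avgv F)) =
  avg (fun k => dotv (F k) (F k)) - dotv (avgv F) (avgv F).
Proof. by have := dotv_sum_center F; rewrite !card_ord; apply. Qed.

Lemma avgB (F G : 'I_n -> R) : avg (fun k => F k - G k) = avg F - avg G.
Proof. by rewrite /avg sumrB mulrBr. Qed.

Lemma avgvB (d : nat) (F G : 'I_n -> 'rV[R]_d) :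
  avgv (fun k => F k - G k) = avgv F - avgv G.
Proof. by rewrite /avgv sumrB scalerBr. Qed.

Lemma avgvZ (d : nat) a (F : 'I_n -> 'rV[R]_d) : avgv (fun k => a *: F k) = a *: avgv F.
Proof. by rewrite /avgv -scaler_sumr !scalerA mulrC. Qed.

Lemma avg_sum (I : Type) (r : seq I) (F : I -> 'I_n -> R) :
  avg (fun k => \sum_(i <- r) F i k) = \sum_(i <- r) avg (F i).
Proof. by rewrite /avg exchange_big mulr_sumr. Qed.

Lemma dotv_avgl (d : nat) (F : 'I_n -> 'rV[R]_d) u :
  dotv (avgv F) u = avg (fun k => dotv (F k) u).
Proof. by rewrite dotvZl dotv_suml. Qed.

(** Centering is dropped for [A] but kept for [B], whose negative term is needed for the factor
    [(n - 1) / n]. *)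
Lemma avg_center_le (d : nat) (A B C : 'I_n -> 'rV[R]_d)
    (S := fun k => A k + B k + C k) : avgv C = 0 ->
  avg (fun k => dotv (S k - avgv S) (S k - avgv S)) <=
  3 * (avg (fun k => dotv (A k) (A k))
       + (avg (fun k => dotv (B k) (B k)) - dotv (avgv B) (avgv B))
       + avg (fun k => dotv (C k) (C k))).
Proof.
move=> C0; rewrite -dotv_avg_center.
have SE k : S k - avgv S = (A k - avgv A) + (B k - avgv B) + C k.
  have -> : avgv S = avgv A + avgv B.
    by rewrite -[RHS]addr0 -C0 /avgv -!scalerDr -!big_split.
  by rewrite opprD (addrAC _ (C k)) addrACA.
have AA : avg (fun k => dotv (A k - avgv A) (A k - avgv A)) <= avg (fun k => dotv (A k) (A k)).
  by rewrite dotv_avg_center gerBl dotv_ge0.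
apply: (@le_trans _ _ (avg (fun k => 3 * (dotv (A k - avgv A) (A k - avgv A)
    + dotv (B k - avgv B) (B k - avgv B) + dotv (C k) (C k))))).
  by apply: ler_avg => k; rewrite SE; exact: dotvD3_le.
by rewrite avgZ !avgD; lra.
Qed.

End Average.

(** * The global objective and one averaged step *)

Section Objective.
Context (R : realType) (n d : nat) (dX : measure_display).
Context (Xi : 'I_n -> measurableType dX) (D : forall k, probability (Xi k) R).
Context (f : forall k, 'rV[R]_d -> Xi k -> R) (L : R) (xs : 'rV[R]_d).
Hypothesis n0 : (0 < n)%N.
Hypothesis L0 : 0 <= L.
Hypothesis fint : forall k x, itg (D k) (@f k x).
Hypothesis fcs : forall k z, convex_smooth L (fun x => @f k x z).
Hypothesis xsmin : forall y, global_obj D f xs <= global_obj D f y.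

Local Notation breg k y x z := (bregman (fun u => @f k u z) y x).

Definition local_breg k y x :=
  local_obj D f k y - local_obj D f k x - dotv (local_grad D f k x) (y - x).

Lemma Ex_breg k y x : \int[D k]_z breg k y x z = local_breg k y x.
Proof. exact: (Ex_bregman (fint k) (@fcs k)). Qed.

Lemma local_breg_ge0 k y x : 0 <= local_breg k y x.
Proof. exact: (sample_bregman_ge0 (fint k) (@fcs k)). Qed.

Lemma local_breg_le k y x : local_breg k y x <= L * dotv (y - x) (y - x).
Proof. exact: (sample_bregman_le L0 (fint k) (@fcs k)). Qed.

Lemma avg_local_breg y x : avg (fun k => local_breg k y x) =
  global_obj D f y - global_obj D f x - dotv (avgv (fun k => local_grad D f k x)) (y - x).
Proof.
by rewrite dotv_avgl -!avgB.
Qed.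

Lemma avg_grad_min : avgv (fun k => local_grad D f k xs) = 0.
Proof.
have /= := fun y => avg_local_breg y xs.
move: (avgv _) => u hu; apply: dotv_eq0.
(* A gradient step from [xs] would otherwise decrease the objective. *)
pose s := (2 * (L + 1))^-1.
have s0 : 0 < s by rewrite invr_gt0 mulr_gt0// ltr_wpDl.
pose y := xs - s *: u.
have yx : y - xs = - (s *: u) by rewrite /y addrC addKr.
have h : avg (fun k => local_breg k y xs) <= L * dotv (y - xs) (y - xs).
  by rewrite -[leRHS](avg_cst n0); apply: ler_avg => k; exact: local_breg_le.
move: h (xsmin y); rewrite hu yx !dotvE !opprK mulrA.
(* Using [L + 1] in [s] covers [L = 0] and keeps [L * s] below 1/2, so the linear decrease wins over
   the quadratic term. *)
have Ls : L * s = 2^-1 - s.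
  by rewrite /s; field; rewrite gt_eqF// ltr_wpDl.
rewrite Ls => h2 h.
have {}h2 : s * dotv u u <= (2^-1 - s) * (s * dotv u u) by lra.
have {}h2 : (2^-1 + s) * (s * dotv u u) <= 0 by lra.
have s2 : 0 < 2^-1 + s by rewrite addr_gt0.
by move: h2; rewrite pmulr_rle0// pmulr_rle0.
Qed.

Lemma avg_breg_min y : avg (fun k => local_breg k y xs) =
  global_obj D f y - global_obj D f xs.
Proof. by rewrite avg_local_breg avg_grad_min dotv0l subr0. Qed.

Lemma suboptimality_ge0 y : 0 <= global_obj D f y - global_obj D f xs.
Proof. by rewrite subr_ge0. Qed.

Lemma suboptimality_le y : global_obj D f y - global_obj D f xs <= L * dotv (y - xs) (y - xs).
Proof.
rewrite -avg_breg_min -[leRHS](avg_cst n0).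
by apply: ler_avg => k; exact: local_breg_le.
Qed.

(** The supporting affine function at the weighted mean lies below the objective, and its linear
    part averages to 0. *)
Lemma global_obj_jensen (J : finType) (w : J -> R) (y : J -> 'rV[R]_d)
    (W := \sum_j w j) : (forall j, 0 <= w j) -> 0 < W ->
  global_obj D f (W^-1 *: \sum_j w j *: y j) <= W^-1 * \sum_j w j * global_obj D f (y j).
Proof.
move=> w0 W0; set z := W^-1 *: _.
pose g := avgv (fun k => local_grad D f k z).
have below j : global_obj D f z + dotv g (y j - z) <= global_obj D f (y j).
  have : 0 <= avg (fun k => local_breg k (y j) z).
    by rewrite -(avg_cst n0 0); apply: ler_avg => k; exact: local_breg_ge0.
  by rewrite avg_local_breg -/g; lra.
have zE : \sum_j w j *: (y j - z) = 0.
  under eq_bigr do rewrite scalerBr.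
  by rewrite sumrB -scaler_suml /z scalerA mulfV ?scale1r ?subrr// gt_eqF.
rewrite mulrC ler_pdivlMr//.
have := ler_sum (index_enum J) (fun j (_ : true) => ler_wpM2l (w0 j) (below j)).
move/(le_trans _); apply; under eq_bigr do rewrite mulrDr -dotvZr.
by rewrite big_split/= -dotv_sumr zE dotvC dotv0l addr0 -mulr_suml mulrC.
Qed.

Lemma continuous_global_obj (x : 'rV[R]_d) : global_obj D f y @[y --> x] --> global_obj D f x.
Proof.
have FF := nbhs_row_filter x.
apply: cvgM; first exact: cvg_cst.
by apply: cvgr_sum => k; exact: (continuous_Ex L0 (fint k) (@fcs k)).
Qed.

Section Step.
Variables (x : 'I_n -> 'rV[R]_d) (z : forall k, Xi k) (eta : R).
Hypothesis eta0 : 0 <= eta.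
Let xb := avgv x.
Let g k := sgrad f (x k) (z k).
Let gs k := sgrad f xs (z k).
Let v := avg (fun k => dotv (x k - xb) (x k - xb)).

(** Pass through the gradient at the mean iterate: the Lipschitz bound charges the first part to the
    spread, cocoercivity the second to the divergence from [xs]. *)
Lemma grad_diff_le k : dotv (g k - gs k) (g k - gs k) <=
  2 * L ^+ 2 * dotv (x k - xb) (x k - xb) + 8 * L * breg k xb xs (z k).
Proof.
have -> : g k - gs k = (g k - sgrad f xb (z k)) + (sgrad f xb (z k) - gs k).
  by rewrite addrA subrK.
have := grad_cocoercive xb xs L0 (fcs (z k)).
have := grad_lipschitz (x k) xb L0 (fcs (z k)).
have := dotvD_le (g k - sgrad f xb (z k)) (sgrad f xb (z k) - gs k).
by rewrite /g /gs /sgrad; lra.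
Qed.

Lemma avg_grad_diff_le : avg (fun k => dotv (g k - gs k) (g k - gs k)) <=
  2 * L ^+ 2 * v + 8 * L * avg (fun k => breg k xb xs (z k)).
Proof.
by rewrite /v -!avgZ -avgD; apply: ler_avg => k; exact: grad_diff_le.
Qed.

(** The bound holds sample by sample. The product of [xb - xs] with the gradients at [xs] is left as
    it is, because its expectation vanishes. *)
Lemma step_le :
  dotv (xb - eta *: avgv g - xs) (xb - eta *: avgv g - xs) <=
  dotv (xb - xs) (xb - xs)
  + 2 * eta * (L * v - avg (fun k => breg k xb xs (z k))
               - avg (fun k => breg k xs (x k) (z k)) - dotv (xb - xs) (avgv gs))
  + eta ^+ 2 * (4 * L ^+ 2 * v + 16 * L * avg (fun k => breg k xb xs (z k))
                + 2 * dotv (avgv gs) (avgv gs)).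
Proof.
have gd : avgv g = avgv (fun k => g k - gs k) + avgv gs.
  by rewrite avgvB subrK.
(* Of the three divergences only the one between the mean and the local iterate has the wrong sign;
   smoothness charges it to the spread. The one from [xs] to the local iterate is kept for strong
   convexity. *)
have inner : - dotv (xb - xs) (avgv (fun k => g k - gs k)) <=
    L * v - avg (fun k => breg k xb xs (z k)) - avg (fun k => breg k xs (x k) (z k)).
  rewrite dotvC dotv_avgl /v -avgZ -!avgB -mulN1r -avgZ.
  apply: ler_avg => k; rewrite bregman_three_point.
  by have := bregman_le xb (x k) L0 (fcs (z k)); rewrite (dotvBC xb); lra.
have sq : dotv (avgv g) (avgv g) <=
    4 * L ^+ 2 * v + 16 * L * avg (fun k => breg k xb xs (z k)) + 2 * dotv (avgv gs) (avgv gs).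
  have := dotv_avg_le n0 (fun k => g k - gs k); have := avg_grad_diff_le.
  by have := dotvD_le (avgv (fun k => g k - gs k)) (avgv gs); rewrite -gd; lra.
have -> : xb - eta *: avgv g - xs = (xb - xs) - eta *: avgv g by rewrite addrAC.
have -> : dotv (xb - xs - eta *: avgv g) (xb - xs - eta *: avgv g) =
    dotv (xb - xs) (xb - xs) + 2 * eta * (- dotv (xb - xs) (avgv g))
    + eta ^+ 2 * dotv (avgv g) (avgv g).
  move: (xb - xs) (avgv g) => a b.
  by rewrite !(dotvDl, dotvDr, dotvNl, dotvNr, dotvZl, dotvZr) (dotvC b a); ring.
apply: lerD; last by rewrite ler_wpM2l ?sqr_ge0.
rewrite lerD2l ler_wpM2l ?mulr_ge0//.
by rewrite [in leLHS]gd dotvDr; lra.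
Qed.

End Step.

End Objective.

(** * Local SGD *)

Section LocalSGD.
Context (R : realType) (n d : nat) (dX dO : measure_display).
Context (Xi : 'I_n -> measurableType dX) (D : forall k, probability (Xi k) R).
Context (f : forall k, 'rV[R]_d -> Xi k -> R) (L mu sigma zeta : R) (xs x0 : 'rV[R]_d).
Context (T : nat) (eta : R) (I : seq nat).
Context (Omega : measurableType dO) (P : probability Omega R).
Context (xi : nat -> forall k, {mfun Omega >-> Xi k}).
Hypothesis n0 : (0 < n)%N.
Hypothesis L0 : 0 <= L.
Hypothesis eta0 : 0 <= eta.
Hypothesis mu0 : 0 <= mu.
Hypothesis fint : forall k x, itg (D k) (@f k x).
Hypothesis fcs : forall k z, convex_smooth L (fun x => @f k x z).
Hypothesis fsc : forall k y x, mu / 2 * dotv (y - x) (y - x) <= local_breg D f k y x.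
Hypothesis xsmin : forall y, global_obj D f xs <= global_obj D f y.
Hypothesis noise : (sigma ^+ 2)%:E = noise_at D f xs.
Hypothesis hetero : zeta ^+ 2 = heterogeneity_at D f xs.
Hypothesis distxi : forall t k A, (t < T)%N -> measurable A ->
  distribution P (xi t k) A = D k A.
Hypothesis indep : mutually_independent P
  (fun q : 'I_T * 'I_n => (xi q.1 q.2 : Omega -> Xi q.2)).

Local Notation Ex Y := (\int[P]_w Y w).
Local Notation breg k y x z := (bregman (fun u => @f k u z) y x).
Local Notation X := (fun q : 'I_T * 'I_n => xi q.1 q.2).

Lemma vmeas_sgrad d0 (T0 : measurableType d0) k (Y : T0 -> 'rV[R]_d) (Z : T0 -> Xi k) :
  vmeas Y -> measurable_fun setT Z -> vmeas (fun w => sgrad f (Y w) (Z w)).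
Proof.
move=> mY mZ i.
apply: (@measurable_comp_caratheodory _ _ _ _ _ _ (fun y z => sgrad f y z 0 i)) => //.
- by move=> y; exact: (measurable_grad (fint k) (@fcs k)).
- by move=> z y; exact: (continuous_grad L0 (@fcs k)).
Qed.

(** The domain is arbitrary and only samples before [t] are constrained, so that this applies to
    [Omega] and to [others X q] alike. *)
Lemma vmeas_local_sgd d0 (T0 : measurableType d0) (s : nat -> forall k, T0 -> Xi k) t :
  (forall r k, (r < t)%N -> measurable_fun setT (s r k)) ->
  forall k, vmeas (fun w => local_sgd f x0 eta I (fun r j => s r j w) t k).
Proof.
elim: t => [|t IH] ms k i /=; first exact: measurable_cst.
have my j : vmeas (fun w => local_sgd f x0 eta I (fun r j => s r j w) t j
    - eta *: sgrad f (local_sgd f x0 eta I (fun r j => s r j w) t j) (s t j w)).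
  have mx : vmeas (fun w => local_sgd f x0 eta I (fun r j => s r j w) t j).
    by apply: IH => r l rt; apply: ms; exact: ltnW.
  apply: vmeasB => //; apply: vmeasZ.
  by apply: vmeas_sgrad => //; exact: ms.
case: (t.+1 \in I); last exact: my.
by apply: vmeasZ; exact: vmeas_sum.
Qed.

Definition sgd t k w := local_sgd f x0 eta I (fun r j => xi r j w) t k.

Lemma vmeas_sgd t k : vmeas (sgd t k).
Proof. by apply: vmeas_local_sgd => r j _. Qed.

(** Iterates up to time [q.1] only use samples of strictly earlier steps, hence never [X q]. *)
Lemma vmeas_sgd_others (q : 'I_T * 'I_n) t k : (t <= q.1)%N ->
  vmeas (sgd t k : others X q -> 'rV[R]_d).
Proof.
move=> tq; apply: (@vmeas_local_sgd _ (others X q) xi) => r j rt.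
have rT : (r < T)%N by rewrite (leq_trans rt)// (leq_trans tq)// ltnW.
apply: (@others_measurable _ _ _ _ _ X q (Ordinal rT, j)).
by apply/eqP => qE; move: rt; rewrite ltnNge -qE/= in tq *; rewrite tq.
Qed.

(* Only the noise at the minimizer is assumed square integrable; the gradients
   elsewhere differ from it by a Lipschitz term. *)
Definition noisev k (z : Xi k) : 'rV[R]_d := sgrad f xs z - local_grad D f k xs.

Definition noise_var k := \int[D k]_z dotv (noisev z) (noisev z).

Lemma vmeas_noisev k : vmeas (@noisev k).
Proof.
apply: vmeasB; last exact: vmeas_cst.
exact: (measurable_grad (fint k) (@fcs k) xs).
Qed.

(** Finiteness is encoded in [noise]: an average of nonnegative extended reals that equals a real
    number has finite terms. *)
Lemma noise_fin k : (\int[D k]_z (norm2 (@noisev k z) ^+ 2)%:E < +oo)%E.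
Proof.
have t0 j : (0 <= \int[D j]_z (norm2 (@noisev j z) ^+ 2)%:E)%E.
  by apply: integral_ge0 => z _; rewrite lee_fin sqr_ge0.
apply: (@le_lt_trans _ _ (\sum_(j < n) \int[D j]_z (norm2 (@noisev j z) ^+ 2)%:E)%E).
  by rewrite (bigD1 k)//= leeDl// sume_ge0.
have S0 : (0 <= \sum_(j < n) \int[D j]_z (norm2 (@noisev j z) ^+ 2)%:E)%E.
  by apply: sume_ge0.
move: noise; rewrite /noise_at -/(noisev _).
case: (\sum_(j < n) _)%E S0 => [r|_|//]; first by rewrite ltry.
by rewrite gt0_muley// lte_fin invr_gt0 natn_gt0.
Qed.

Lemma itg_noise k : itg (D k) (fun z => dotv (@noisev k z) (@noisev k z)).
Proof.
apply/integrableP; split.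
  apply/measurable_EFinP; apply: measurable_sum => i.
  by apply: measurable_funM; exact: vmeas_noisev.
apply: le_lt_trans (noise_fin k); rewrite le_eqVlt; apply/orP; left; apply/eqP.
by apply: eq_integral => z _; rewrite /= norm2_sqr ger0_norm ?dotv_ge0.
Qed.

Lemma avg_noise_var : avg noise_var = sigma ^+ 2.
Proof.
apply: EFin_inj; rewrite noise /noise_at EFinM; congr (_ * _)%E.
rewrite -sumEFin; apply: eq_bigr => k _; rewrite -integral_Ex; last exact: itg_noise.
by apply: eq_integral => z _; rewrite norm2_sqr.
Qed.

Lemma vsqitg_noisev k : vsqitg (D k) (@noisev k).
Proof. by apply: (vsqitg_le (@vmeas_noisev k) (itg_noise k)). Qed.

Lemma Ex_noisev k i : \int[D k]_z @noisev k z 0 i = 0.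
Proof.
have ig := itg_grad (fint k) (@fcs k) xs i.
have := ExB ig (itg_cst (D k) (local_grad D f k xs 0 i)).
rewrite Ex_cst [in RHS]mxE subrr => <-.
by apply: eq_Rintegral => z _; rewrite mxE [X in _ + X]mxE.
Qed.

Lemma distX (q : 'I_T * 'I_n) A : measurable A -> distribution P (X q) A = D q.2 A.
Proof. by move=> mA; exact: distxi. Qed.

Lemma vsqitg_noise t k : (t < T)%N -> vsqitg P (fun w => noisev (xi t k w)).
Proof.
move=> tT i; have [mc ic] := vsqitg_noisev k i; split; first exact: (measurableT_comp mc).
exact: (@itg_distribution _ _ _ _ P _ _ X (fun q => D q.2) (Ordinal tT, k)
  (@distX (Ordinal tT, k)) _ ic).
Qed.

Lemma vsqitg_sgd t k : (t <= T)%N -> vsqitg P (sgd t k).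
Proof.
elim: t k => [|t IH] k tT /=; first exact: vsqitg_cst.
have sy j : vsqitg P (fun w => sgd t j w - eta *: sgrad f (sgd t j w) (xi t j w)).
  have sx := IH j (ltnW tT).
  apply: vsqitgB => //; apply: vsqitgZ.
  have -> : (fun w => sgrad f (sgd t j w) (xi t j w)) = (fun w =>
      (sgrad f (sgd t j w) (xi t j w) - sgrad f xs (xi t j w))
      + (noisev (xi t j w) + local_grad D f j xs)).
    by apply/funext => w; rewrite /noisev subrK subrK.
  apply: vsqitgD; last by apply: vsqitgD; [exact: vsqitg_noise|exact: vsqitg_cst].
  have sxs := vsqitgB sx (vsqitg_cst P xs).
  apply: (vsqitg_le _ (itgZ (L ^+ 2) (itg_dotv sxs sxs))) => [|w].
    apply: vmeasB; apply: vmeas_sgrad => //; exact: vmeas_sgd.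
  exact: grad_lipschitz.
rewrite /sgd /=; case: (t.+1 \in I); last exact: sy.
by apply: vsqitgZ; apply: vsqitg_sum => j _; exact: sy.
Qed.

Lemma Ex_noise_sqr t k : (t < T)%N ->
  Ex (fun w => dotv (noisev (xi t k w)) (noisev (xi t k w))) = noise_var k.
Proof.
move=> tT; exact: (@Ex_distribution _ _ _ _ P _ _ X (fun q => D q.2) (Ordinal tT, k)
  (@distX (Ordinal tT, k)) _ (itg_noise k)).
Qed.

Lemma Ex_noise_cross t k (Y : Omega -> 'rV[R]_d) (tT : (t < T)%N) :
  vmeas (Y : others X (Ordinal tT, k) -> 'rV[R]_d) -> vsqitg P Y ->
  Ex (fun w => dotv (Y w) (noisev (xi t k w))) = 0.
Proof.
move=> mY sY; exact: (@Ex_dotv0 _ _ _ _ P _ _ X (fun q => D q.2) indep (Ordinal tT, k)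
  (@distX (Ordinal tT, k)) _ _ _ mY sY (vsqitg_noisev k) (Ex_noisev k)).
Qed.

(** Noises of distinct cells are independent and centered, so the cross terms vanish. The predicate
    [p] will select one time, one machine over a window, or a whole window. *)
Lemma Ex_noise_sum (p : pred ('I_T * 'I_n)) (F := fun w => \sum_(q | p q) noisev (X q w)) :
  Ex (fun w => dotv (F w) (F w)) = \sum_(q | p q) noise_var q.2.
Proof.
have sq (q : 'I_T * 'I_n) : vsqitg P (fun w => noisev (X q w)) by exact: vsqitg_noise.
have sF : vsqitg P F by exact: vsqitg_sum.
under eq_Rintegral do rewrite [X in dotv X]/F dotv_suml.
rewrite Ex_sum => [|q _]; last exact: itg_dotv.
apply: eq_bigr => q pq.
under eq_Rintegral do rewrite /F dotv_sumr.
rewrite Ex_sum => [|r _]; last exact: itg_dotv.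
rewrite (bigD1 q)//= Ex_noise_sqr// big1 ?addr0// => r /andP[pr rq].
under eq_Rintegral do rewrite dotvC.
case: q pq sq rq => -[t tT] k pq sq rq /=.
apply: (@Ex_noise_cross t k (fun w => noisev (X r w)) tT) => // i.
exact: (measurableT_comp (vmeas_noisev i) (@others_measurable _ _ _ _ _ X (Ordinal tT, k) r rq)).
Qed.

Definition mean t w := avgv (fun k => sgd t k w).

Definition dist2 t := Ex (fun w => dotv (mean t w - xs) (mean t w - xs)).

Definition subopt t := Ex (fun w => global_obj D f (mean t w) - global_obj D f xs).

Definition spread t :=
  Ex (fun w => avg (fun k => dotv (sgd t k w - mean t w) (sgd t k w - mean t w))).

Lemma itg_avg (F : 'I_n -> Omega -> R) : (forall k, itg P (F k)) -> itg P (fun w => avg (F^~ w)).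
Proof. by move=> iF; apply: itgZ; apply: itg_sum. Qed.

Lemma Ex_avg (F : 'I_n -> Omega -> R) : (forall k, itg P (F k)) ->
  Ex (fun w => avg (F^~ w)) = avg (fun k => Ex (F k)).
Proof. by move=> iF; rewrite ExZ ?Ex_sum//; exact: itg_sum. Qed.

Lemma vsqitg_mean t : (t <= T)%N -> vsqitg P (mean t).
Proof. by move=> tT; apply: vsqitgZ; apply: vsqitg_sum => k _; exact: vsqitg_sgd. Qed.

Lemma vmeas_mean_others (q : 'I_T * 'I_n) t : (t <= q.1)%N ->
  vmeas (mean t : others X q -> 'rV[R]_d).
Proof. by move=> tq; apply: vmeasZ; apply: vmeas_sum => k; exact: vmeas_sgd_others. Qed.

Lemma itg_suboptimality (Y : Omega -> 'rV[R]_d) : vsqitg P Y ->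
  itg P (fun w => global_obj D f (Y w) - global_obj D f xs).
Proof.
move=> sY; have sYx := vsqitgB sY (vsqitg_cst P xs).
apply: (itg_le _ (itgZ L (itg_dotv sYx sYx))) => [|w]; last first.
  by rewrite ger0_norm ?suboptimality_ge0//; exact: suboptimality_le n0 L0 fint fcs xsmin _.
apply: measurable_funB => //.
apply: (@measurable_comp_caratheodory _ _ _ _ Omega Omega
  (fun y _ => global_obj D f y) Y id) => //.
- by move=> z y; exact: (continuous_global_obj L0 fint fcs).
- exact: vsqitg_meas.
Qed.

Section Coupling.
Variables (t : nat) (k : 'I_n) (tT : (t < T)%N) (Y : Omega -> 'rV[R]_d).
Hypothesis mY : vmeas (Y : others X (Ordinal tT, k) -> 'rV[R]_d).
Hypothesis sY : vsqitg P Y.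

(** The sample of cell [(t, k)] is integrated out with [Y] frozen; the quadratic bound on [g]
    supplies integrability. *)
Lemma Ex_coupling (g : 'rV[R]_d -> Xi k -> R) (G : 'rV[R]_d -> R) :
  (forall y z, 0 <= g y z) -> (forall y z, g y z <= L * dotv (y - xs) (y - xs)) ->
  (forall y, itg (D k) (g y)) -> (forall z, continuous (g^~ z)) ->
  (forall y, \int[D k]_z g y z = G y) ->
  [/\ itg P (fun w => g (Y w) (xi t k w)), itg P (fun w => G (Y w)) &
      Ex (fun w => g (Y w) (xi t k w)) = Ex (fun w => G (Y w))].
Proof.
move=> g0 gL ig cg gG; have sYx := vsqitgB sY (vsqitg_cst P xs).
have igY : itg P (fun w => g (Y w) (xi t k w)).
  apply: (itg_le _ (itgZ L (itg_dotv sYx sYx))) => [|w]; last by rewrite ger0_norm.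
  apply: measurable_comp_caratheodory => //; last exact: vsqitg_meas.
  by move=> y; exact: itg_measurable.
have [iG eG] := @itg_Ex_caratheodory _ _ _ _ P _ _ X (fun q => D q.2) indep (Ordinal tT, k)
  (@distX (Ordinal tT, k)) _ g Y g0 ig cg mY igY.
have GE : (fun w => G (Y w)) = (fun w => \int[D k]_z g (Y w) z).
  by apply/funext => w; rewrite gG.
by split=> //; rewrite GE.
Qed.

Lemma Ex_breg_l :
  [/\ itg P (fun w => breg k (Y w) xs (xi t k w)), itg P (fun w => local_breg D f k (Y w) xs) &
      Ex (fun w => breg k (Y w) xs (xi t k w)) = Ex (fun w => local_breg D f k (Y w) xs)].
Proof.
apply: (Ex_coupling (g := fun y z => breg k y xs z) (G := fun y => local_breg D f k y xs)).
- by move=> y z; exact: bregman_ge0 (fcs z).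
- by move=> y z; exact: bregman_le L0 (fcs z).
- by move=> y; exact: (itg_bregman (fint k) (@fcs k)).
- by move=> z y; exact: (continuous_bregman_l (@fcs k)).
- by move=> y; exact: Ex_breg fint fcs _ _ _.
Qed.

Lemma Ex_breg_r :
  [/\ itg P (fun w => breg k xs (Y w) (xi t k w)), itg P (fun w => local_breg D f k xs (Y w)) &
      Ex (fun w => breg k xs (Y w) (xi t k w)) = Ex (fun w => local_breg D f k xs (Y w))].
Proof.
apply: (Ex_coupling (g := fun y z => breg k xs y z) (G := fun y => local_breg D f k xs y)).
- by move=> y z; exact: bregman_ge0 (fcs z).
- by move=> y z; rewrite dotvBC; exact: bregman_le L0 (fcs z).
- by move=> y; exact: (itg_bregman (fint k) (@fcs k)).
- by move=> z y; exact: (continuous_bregman_r L0 (@fcs k)).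
- by move=> y; exact: Ex_breg fint fcs _ _ _.
Qed.

End Coupling.

(** Once the fresh samples are integrated out, the linear terms cancel because the mean gradient at
    [xs] is 0. *)
Lemma Ex_breg_mean t : (t < T)%N ->
  Ex (fun w => avg (fun k => breg k (mean t w) xs (xi t k w))) = subopt t.
Proof.
move=> tT.
have h k := @Ex_breg_l t k tT (mean t) (vmeas_mean_others (leqnn _)) (vsqitg_mean (ltnW tT)).
rewrite (Ex_avg (F := fun k w => breg k (mean t w) xs (xi t k w))); last by move=> k; case: (h k).
rewrite /subopt; under [RHS]eq_Rintegral do rewrite -(avg_breg_min n0 L0 fint fcs xsmin).
rewrite (Ex_avg (F := fun k w => local_breg D f k (mean t w) xs)); last by move=> k; case: (h k).
by congr avg; apply/funext => k; case: (h k).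
Qed.

(** The source of the contraction: strong convexity at each machine, then convexity of the squared
    norm to pass to the mean iterate. *)
Lemma Ex_breg_sgd t : (t < T)%N ->
  mu / 2 * dist2 t <= Ex (fun w => avg (fun k => breg k xs (sgd t k w) (xi t k w))).
Proof.
move=> tT.
have h k := @Ex_breg_r t k tT (sgd t k) (vmeas_sgd_others k (leqnn _)) (vsqitg_sgd k (ltnW tT)).
rewrite (Ex_avg (F := fun k w => breg k xs (sgd t k w) (xi t k w))); last by move=> k; case: (h k).
have -> : avg (fun k => Ex (fun w => breg k xs (sgd t k w) (xi t k w))) =
    Ex (fun w => avg (fun k => local_breg D f k xs (sgd t k w))).
  rewrite (Ex_avg (F := fun k w => local_breg D f k xs (sgd t k w))); last by move=> k; case: (h k).
  by congr avg; apply/funext => k; case: (h k).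
have smx := vsqitgB (vsqitg_mean (ltnW tT)) (vsqitg_cst P xs).
rewrite -ExZ; last exact: itg_dotv.
apply: Ex_le => [||w].
- by apply: itgZ; exact: itg_dotv.
- by apply: (itg_avg (F := fun k w => local_breg D f k xs (sgd t k w))) => k; case: (h k).
have -> : mean t w - xs = avgv (fun k => sgd t k w - xs) by rewrite avgvB (avgv_cst n0).
apply: (@le_trans _ _ (mu / 2 * avg (fun k => dotv (sgd t k w - xs) (sgd t k w - xs)))).
  by rewrite ler_wpM2l ?divr_ge0//; exact: dotv_avg_le.
by rewrite -avgZ; apply: ler_avg => k; rewrite dotvBC; exact: fsc.
Qed.

(** Synchronization leaves the mean unchanged, so the mean follows the same recursion at every
    time. *)
Lemma mean_step t w : mean t.+1 w =
  mean t w - eta *: avgv (fun k => sgrad f (sgd t k w) (xi t k w)).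
Proof.
have e : avgv (fun k => sgd t k w - eta *: sgrad f (sgd t k w) (xi t k w)) =
    mean t w - eta *: avgv (fun k => sgrad f (sgd t k w) (xi t k w)).
  by rewrite avgvB /avgv -scaler_sumr !scalerA (mulrC eta).
rewrite -e /mean /sgd /=; case: (t.+1 \in I) => //.
by rewrite avgv_cst.
Qed.

Lemma avg_grad_noise (t : nat) w :
  avgv (fun k => sgrad f xs (xi t k w)) = avgv (fun k => noisev (xi t k w)).
Proof. by rewrite [RHS]avgvB (avg_grad_min n0 L0 fint fcs xsmin) subr0. Qed.

Lemma sum_pair_row (V : nmodType) (s : 'I_T) (F : 'I_T * 'I_n -> V) :
  \sum_(q | q.1 == s) F q = \sum_(k < n) F (s, k).
Proof.
transitivity (\sum_(q | (q.1 == s) && xpredT q.2) F (q.1, q.2)).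
  by apply: eq_big => [q|[]//]; rewrite andbT.
by rewrite -(pair_big (fun r => r == s) xpredT (fun r k => F (r, k)))/= big_pred1_eq.
Qed.

(** The noises of the [n] machines are uncorrelated, so averaging divides their variance by [n]. *)
Lemma Ex_mean_noise_sqr t : (t < T)%N ->
  Ex (fun w => dotv (avgv (fun k => sgrad f xs (xi t k w))) (avgv (fun k => sgrad f xs (xi t k w))))
  = sigma ^+ 2 / n%:R.
Proof.
move=> tT; under eq_Rintegral do rewrite avg_grad_noise.
have := Ex_noise_sum (fun q => q.1 == Ordinal tT).
rewrite sum_pair_row -avg_noise_var /avg /avgv.
under eq_Rintegral do rewrite sum_pair_row.
have sn : vsqitg P (fun w => \sum_(k < n) noisev (xi t k w)).
  by apply: vsqitg_sum => k _; exact: vsqitg_noise.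
move=> /= eS; under eq_Rintegral do rewrite !(dotvZl, dotvZr) mulrA.
by rewrite ExZ ?eS; [ring|exact: itg_dotv].
Qed.

Lemma Ex_mean_noise_cross t : (t < T)%N ->
  Ex (fun w => dotv (mean t w - xs) (avgv (fun k => sgrad f xs (xi t k w)))) = 0.
Proof.
move=> tT; under eq_Rintegral do rewrite avg_grad_noise dotvC dotv_avgl.
have smx := vsqitgB (vsqitg_mean (ltnW tT)) (vsqitg_cst P xs).
rewrite (Ex_avg (F := fun k w => dotv (noisev (xi t k w)) (mean t w - xs))); last first.
  by move=> k; apply: itg_dotv => //; exact: vsqitg_noise.
rewrite /avg big1 ?mulr0// => k _; under eq_Rintegral do rewrite dotvC.
apply: Ex_noise_cross => //.
by apply: vmeasB; [exact: vmeas_mean_others|exact: vmeas_cst].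
Qed.

Lemma itg_spread t : (t <= T)%N ->
  itg P (fun w => avg (fun k => dotv (sgd t k w - mean t w) (sgd t k w - mean t w))).
Proof.
move=> tT; apply: (itg_avg (F := fun k w => dotv (sgd t k w - mean t w) (sgd t k w - mean t w))) => k.
by apply: itg_dotv; apply: vsqitgB; (exact: vsqitg_sgd || exact: vsqitg_mean).
Qed.

Lemma dist2_step t : (t < T)%N -> dist2 t.+1 <=
  dist2 t + 2 * eta * (L * spread t - subopt t - mu / 2 * dist2 t)
  + eta ^+ 2 * (4 * L ^+ 2 * spread t + 16 * L * subopt t + 2 * (sigma ^+ 2 / n%:R)).
Proof.
move=> tT.
pose A w := dotv (mean t w - xs) (mean t w - xs).
pose v w := avg (fun k => dotv (sgd t k w - mean t w) (sgd t k w - mean t w)).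
pose B1 w := avg (fun k => breg k (mean t w) xs (xi t k w)).
pose B2 w := avg (fun k => breg k xs (sgd t k w) (xi t k w)).
pose gs w := avgv (fun k => sgrad f xs (xi t k w)).
pose C w := dotv (mean t w - xs) (gs w).
pose S w := dotv (gs w) (gs w).
have smx := vsqitgB (vsqitg_mean (ltnW tT)) (vsqitg_cst P xs).
have smx1 := vsqitgB (vsqitg_mean tT) (vsqitg_cst P xs).
have sgs : vsqitg P gs.
  rewrite /gs; under eq_fun do rewrite avg_grad_noise.
  by apply: vsqitgZ; apply: vsqitg_sum => k _; exact: vsqitg_noise.
have iA : itg P A by exact: itg_dotv.
have iv : itg P v by exact/itg_spread/ltnW.
have iB1 : itg P B1.
  apply: (itg_avg (F := fun k w => breg k (mean t w) xs (xi t k w))) => k.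
  by case: (@Ex_breg_l t k tT (mean t) (vmeas_mean_others (leqnn _)) (vsqitg_mean (ltnW tT))).
have iB2 : itg P B2.
  apply: (itg_avg (F := fun k w => breg k xs (sgd t k w) (xi t k w))) => k.
  by case: (@Ex_breg_r t k tT (sgd t k) (vmeas_sgd_others k (leqnn _)) (vsqitg_sgd k (ltnW tT))).
have iC : itg P C by exact: itg_dotv.
have iS : itg P S by exact: itg_dotv.
have iZ1 : itg P (fun w => L * v w - B1 w - B2 w - C w).
  by do 3![apply: itgB => //]; exact: itgZ.
have iZ2 : itg P (fun w => 4 * L ^+ 2 * v w + 16 * L * B1 w + 2 * S w).
  by apply: itgD; [apply: itgD|]; exact: itgZ.
(* The right-hand side is the expectation of the bound of [step_le] plus a remainder that is
   nonnegative by [Ex_breg_sgd]. *)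
have -> : dist2 t + 2 * eta * (L * spread t - subopt t - mu / 2 * dist2 t)
  + eta ^+ 2 * (4 * L ^+ 2 * spread t + 16 * L * subopt t + 2 * (sigma ^+ 2 / n%:R)) =
  Ex (fun w => A w + 2 * eta * (L * v w - B1 w - B2 w - C w)
       + eta ^+ 2 * (4 * L ^+ 2 * v w + 16 * L * B1 w + 2 * S w))
  + 2 * eta * (Ex B2 - mu / 2 * dist2 t).
  rewrite ExD; [|by apply: itgD => //; exact: itgZ|exact: itgZ].
  rewrite ExD//; last exact: itgZ.
  rewrite ExZ// ExZ//.
  rewrite (ExB (X := fun w => L * v w - B1 w - B2 w))//; last by do 2![apply: itgB => //]; exact: itgZ.
  rewrite (ExB (X := fun w => L * v w - B1 w))//; last by apply: itgB => //; exact: itgZ.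
  rewrite (ExB (X := fun w => L * v w))//; last exact: itgZ.
  rewrite (ExD (X := fun w => 4 * L ^+ 2 * v w + 16 * L * B1 w)); [|by apply: itgD; exact: itgZ|exact: itgZ].
  rewrite (ExD (X := fun w => 4 * L ^+ 2 * v w)); [|exact: itgZ|exact: itgZ].
  have eC : Ex C = 0 := Ex_mean_noise_cross tT.
  have eS : Ex S = sigma ^+ 2 / n%:R := Ex_mean_noise_sqr tT.
  have eB1 : Ex B1 = subopt t := Ex_breg_mean tT.
  rewrite (ExZ L iv) (ExZ _ iv) (ExZ _ iB1) (ExZ 2 iS) eC eS eB1.
  rewrite -/(spread t) -/(dist2 t).
  by move: (Ex B2) => b; ring.
rewrite -[leLHS]addr0; apply: lerD; last first.
  by rewrite mulr_ge0 ?mulr_ge0// subr_ge0; exact: Ex_breg_sgd.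
apply: Ex_le => [||w].
- exact: itg_dotv.
- by apply: itgD; [apply: itgD => //; exact: itgZ|exact: itgZ].
rewrite mean_step; exact: step_le.
Qed.

(** * Drift of the machines since the last synchronization *)

Section Window.
Variables t0 t : nat.
Hypothesis t0t : (t0 <= t)%N.
Hypothesis tT : (t <= T)%N.
Hypothesis sync : t0 = 0%N \/ t0 \in I.
Hypothesis nosync : forall s, (t0 < s <= t)%N -> s \notin I.

Lemma sgd_sync k w : sgd t0 k w = mean t0 w.
Proof.
case: sync => [->|]; first by rewrite /mean avgv_cst.
case: t0 => [_|t' tI]; first by rewrite /mean avgv_cst.
by rewrite /mean /sgd /= tI avgv_cst.
Qed.

Lemma sgd_window k w : sgd t k w =
  mean t0 w - eta *: \sum_(t0 <= s < t) sgrad f (sgd s k w) (xi s k w).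
Proof.
elim: t t0t nosync => [|t' IH] t0t' ns.
  by move: t0t' (sgd_sync k w); rewrite leqn0 => /eqP -> <-; rewrite big_geq// scaler0 subr0.
move: t0t'; rewrite leq_eqVlt => /predU1P[t0E|t0t'].
  by rewrite -t0E big_geq// scaler0 subr0 sgd_sync.
rewrite big_nat_recr//= scalerDr opprD addrA -IH//; last first.
  by move=> s /andP[ts st]; apply: ns; rewrite ts ltnW.
by rewrite {1}/sgd /=; have := ns t'.+1; rewrite t0t' leqnn => /(_ isT)/negbTE ->.
Qed.

Let S k w := \sum_(t0 <= s < t) sgrad f (sgd s k w) (xi s k w).

Lemma mean_window w : mean t w = mean t0 w - eta *: avgv (S^~ w).
Proof.
rewrite {1}/mean; under eq_fun do rewrite sgd_window.
by rewrite avgvB (avgv_cst n0) avgvZ.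
Qed.

Local Notation diff s k w := (sgrad f (sgd s k w) (xi s k w) - sgrad f xs (xi s k w)).
Let A k w := \sum_(t0 <= s < t) diff s k w.
Let B k w := \sum_(t0 <= s < t) noisev (xi s k w).
Let tau : R := (t - t0)%:R.

(** The accumulated gradients consist of deviations from the gradients at [xs], noise at [xs], and a
    heterogeneity term whose mean over the machines is 0. *)
Lemma S_split k w : S k w = A k w + B k w + tau *: local_grad D f k xs.
Proof.
have -> : tau *: local_grad D f k xs = \sum_(t0 <= s < t) local_grad D f k xs.
  by rewrite sumr_const_nat scaler_nat.
rewrite -!big_split/=; apply: eq_bigr => s _.
by rewrite /noisev -addrA subrK subrK.
Qed.

(** Cauchy-Schwarz costs a factor [tau] on the gradient deviations. The noise is not bounded here:
    it remains a difference whose expectation is computed exactly. *)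
Lemma spread_pointwise w :
  avg (fun k => dotv (sgd t k w - mean t w) (sgd t k w - mean t w)) <=
  3 * eta ^+ 2 * (
    tau * \sum_(t0 <= s < t)
       (2 * L ^+ 2 * avg (fun k => dotv (sgd s k w - mean s w) (sgd s k w - mean s w))
        + 8 * L * avg (fun k => breg k (mean s w) xs (xi s k w)))
    + (avg (fun k => dotv (B k w) (B k w)) - dotv (avgv (B^~ w)) (avgv (B^~ w)))
    + tau ^+ 2 * zeta ^+ 2).
Proof.
have C0 : avgv (fun k => tau *: local_grad D f k xs) = 0.
  by rewrite avgvZ (avg_grad_min n0 L0 fint fcs xsmin) scaler0.
have SE : S^~ w = (fun k => A k w + B k w + tau *: local_grad D f k xs).
  by apply/funext => k; exact: S_split.
have : avg (fun k => dotv (S k w - avgv (S^~ w)) (S k w - avgv (S^~ w))) <=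
    3 * (avg (fun k => dotv (A k w) (A k w))
    + (avg (fun k => dotv (B k w) (B k w)) - dotv (avgv (B^~ w)) (avgv (B^~ w)))
    + avg (fun k => dotv (tau *: local_grad D f k xs) (tau *: local_grad D f k xs))).
  rewrite -[leLHS]/(let F := S^~ w in avg (fun k => dotv (F k - avgv F) (F k - avgv F))) SE.
  exact: (avg_center_le n0 (A^~ w) (B^~ w) C0).
have -> : avg (fun k => dotv (tau *: local_grad D f k xs) (tau *: local_grad D f k xs)) =
    tau ^+ 2 * zeta ^+ 2.
  rewrite hetero /heterogeneity_at -avgZ; congr avg; apply/funext => k.
  by rewrite !dotvE norm2_sqr mulrA expr2.
have AA : avg (fun k => dotv (A k w) (A k w)) <= tau * \sum_(t0 <= s < t)
       (2 * L ^+ 2 * avg (fun k => dotv (sgd s k w - mean s w) (sgd s k w - mean s w))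
        + 8 * L * avg (fun k => breg k (mean s w) xs (xi s k w))).
  have Ak k : dotv (A k w) (A k w) <=
      tau * \sum_(t0 <= s < t) dotv (diff s k w) (diff s k w).
    exact: dotv_sum_nat_le.
  apply: le_trans (ler_avg Ak) _; rewrite avgZ ler_wpM2l// avg_sum.
  by apply: ler_sum => s _; exact: (avg_grad_diff_le xs L0 fcs (sgd s ^~ w) (fun k => xi s k w)).
have -> : (fun k => dotv (sgd t k w - mean t w) (sgd t k w - mean t w)) =
    (fun k => eta ^+ 2 * dotv (S k w - avgv (S^~ w)) (S k w - avgv (S^~ w))).
  apply/funext => k; rewrite sgd_window mean_window.
  have -> : mean t0 w - eta *: S k w - (mean t0 w - eta *: avgv (S^~ w)) =
      - eta *: (S k w - avgv (S^~ w)).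
    move: (S k w) (avgv _) (mean t0 w) => a e c.
    by apply/rowP => i; rewrite !mxE; ring.
  by rewrite !dotvE; ring.
rewrite avgZ => h; rewrite (mulrC 3) -[leRHS]mulrA ler_wpM2l ?sqr_ge0//.
by apply: le_trans h _; rewrite ler_pM2l//; lra.
Qed.

Lemma sum_window (V : nmodType) (F : nat -> V) :
  \sum_(s < T | (t0 <= s < t)%N) F s = \sum_(t0 <= s < t) F s.
Proof.
rewrite (big_nat_widen _ _ _ _ _ tT) big_geq_mkord/=.
by apply: eq_bigl => s; rewrite andbC.
Qed.

Lemma sum_window_cell (V : nmodType) (F : nat -> 'I_n -> V) k :
  \sum_(q : 'I_T * 'I_n | (t0 <= q.1 < t)%N && (q.2 == k)) F q.1 q.2 =
  \sum_(t0 <= s < t) F s k.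
Proof.
rewrite -(pair_big (fun r : 'I_T => (t0 <= r < t)%N) (fun j => j == k) (fun r j => F r j))/=.
under eq_bigr do rewrite big_pred1_eq.
exact: (sum_window (F^~ k)).
Qed.

Lemma sum_window_row (V : nmodType) (F : nat -> 'I_n -> V) :
  \sum_(q : 'I_T * 'I_n | (t0 <= q.1 < t)%N) F q.1 q.2 =
  \sum_(t0 <= s < t) \sum_(k < n) F s k.
Proof.
rewrite -(sum_window (fun s => \sum_(k < n) F s k)) pair_big_dep/=.
by apply: eq_bigl => q; rewrite andbT.
Qed.

Lemma vsqitg_B k : vsqitg P (B k).
Proof.
rewrite /B; under eq_fun do rewrite -(sum_window (fun s => noisev (xi s k _))).
by apply: vsqitg_sum => s _; exact: vsqitg_noise.
Qed.

Lemma Ex_B k : Ex (fun w => dotv (B k w) (B k w)) = tau * noise_var k.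
Proof.
have := Ex_noise_sum
  (fun q => (t0 <= q.1 < t)%N && (q.2 == k)).
rewrite (sum_window_cell (fun _ => noise_var)) sumr_const_nat -mulr_natl => <-.
by apply: eq_Rintegral => w _; rewrite (sum_window_cell (fun s k => noisev (xi s k w))).
Qed.

Lemma Ex_mean_B : Ex (fun w => dotv (avgv (B^~ w)) (avgv (B^~ w))) = tau * sigma ^+ 2 / n%:R.
Proof.
have /= eB := Ex_noise_sum (fun q => (t0 <= q.1 < t)%N).
rewrite (sum_window_row (fun _ => noise_var)) sumr_const_nat -[X in _ = X]mulr_natl in eB.
have BE w : avgv (B^~ w) = n%:R^-1 *: \sum_(q : 'I_T * 'I_n | (t0 <= q.1 < t)%N) noisev (xi q.1 q.2 w).
  by rewrite /avgv exchange_big (sum_window_row (fun s k => noisev (xi s k w))).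
under eq_Rintegral do rewrite BE dotvZl dotvZr mulrA.
rewrite ExZ; first by rewrite eB -avg_noise_var /avg /tau; ring.
by apply: itg_dotv; apply: vsqitg_sum => q _; exact: vsqitg_noise.
Qed.

(** Independent noises add up linearly in [tau], whereas heterogeneity pushes in the same direction
    at every step and grows like [tau ^+ 2]. *)
Lemma spread_le : spread t <= 3 * eta ^+ 2 * (
    tau * \sum_(t0 <= s < t) (2 * L ^+ 2 * spread s + 8 * L * subopt s)
    + tau * ((n%:R - 1) / n%:R * sigma ^+ 2) + tau ^+ 2 * zeta ^+ 2).
Proof.
pose v s w := avg (fun k => dotv (sgd s k w - mean s w) (sgd s k w - mean s w)).
pose b s w := avg (fun k => breg k (mean s w) xs (xi s k w)).
pose U w := avg (fun k => dotv (B k w) (B k w)).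
pose W w := dotv (avgv (B^~ w)) (avgv (B^~ w)).
have iv s : (s <= T)%N -> itg P (v s) by exact: itg_spread.
have ib s : (s < T)%N -> itg P (b s).
  move=> sT; apply: (itg_avg (F := fun k w => breg k (mean s w) xs (xi s k w))) => k.
  by case: (@Ex_breg_l s k sT (mean s) (vmeas_mean_others (leqnn _)) (vsqitg_mean (ltnW sT))).
have iU : itg P U.
  by apply: (itg_avg (F := fun k w => dotv (B k w) (B k w))) => k; apply: itg_dotv; exact: vsqitg_B.
have iW : itg P W.
  by apply: itg_dotv; apply: vsqitgZ; apply: vsqitg_sum => k _; exact: vsqitg_B.
have sT (s : nat) : (t0 <= s < t)%N -> (s < T)%N by case/andP => _ /leq_trans; apply.
pose Q w := \sum_(t0 <= s < t) (2 * L ^+ 2 * v s w + 8 * L * b s w).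
have iQs s : (t0 <= s < t)%N -> itg P (fun w => 2 * L ^+ 2 * v s w + 8 * L * b s w).
  by move=> /sT h; apply: itgD; apply: itgZ; [exact/iv/ltnW|exact: ib].
have QE w : Q w = \sum_(s <- index_iota t0 t | (t0 <= s < t)%N) (2 * L ^+ 2 * v s w + 8 * L * b s w).
  by rewrite -big_nat.
have iQ : itg P Q.
  have -> : Q = fun w => \sum_(s <- index_iota t0 t | (t0 <= s < t)%N)
      (2 * L ^+ 2 * v s w + 8 * L * b s w) by apply/funext => w; exact: QE.
  by apply: itg_sum => s hs; exact: iQs.
have eU : Ex U = tau * sigma ^+ 2.
  rewrite (Ex_avg (F := fun k w => dotv (B k w) (B k w))); last first.
    by move=> k; apply: itg_dotv; exact: vsqitg_B.
  by rewrite -avg_noise_var -avgZ; congr avg; apply/funext => k; rewrite Ex_B.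
have eQ : Ex Q = \sum_(t0 <= s < t) (2 * L ^+ 2 * spread s + 8 * L * subopt s).
  under eq_Rintegral do rewrite QE.
  rewrite Ex_sum// [RHS]big_nat; apply: eq_bigr => s /[dup] /sT h hs.
  rewrite (ExD (X := fun w => 2 * L ^+ 2 * v s w)); [|exact/itgZ/iv/ltnW|exact/itgZ/ib].
  by rewrite (ExZ _ (iv _ (ltnW h))) (ExZ _ (ib _ h)) (Ex_breg_mean h).
have iR : itg P (fun w => tau * Q w + (U w - W w) + tau ^+ 2 * zeta ^+ 2).
  by apply: itgD; [apply: itgD; [exact: itgZ|exact: itgB]|exact: itg_cst].
have := Ex_le (iv t tT) (itgZ (3 * eta ^+ 2) iR) spread_pointwise.
rewrite ExZ// (ExD (X := fun w => tau * Q w + (U w - W w))); last exact: itg_cst; last first.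
  by apply: itgD; [exact: itgZ|exact: itgB].
rewrite (ExD (X := fun w => tau * Q w)); [|exact: itgZ|exact: itgB].
rewrite (ExZ _ iQ) (ExB iU iW) Ex_cst eQ eU [Ex W]Ex_mean_B => h.
apply: le_trans h _; rewrite le_eqVlt; apply/orP; left; apply/eqP.
by field; exact: natn_neq0.
Qed.

End Window.

Lemma dist2_ge0 t : 0 <= dist2 t.
Proof. by apply: Rintegral_ge0 => w _; exact: dotv_ge0. Qed.

Lemma subopt_ge0 t : 0 <= subopt t.
Proof. by apply: Rintegral_ge0 => w _; exact: suboptimality_ge0. Qed.

Lemma spread_ge0 t : 0 <= spread t.
Proof.
apply: Rintegral_ge0 => w _; rewrite mulr_ge0 ?invr_ge0// sumr_ge0// => k _.
exact: dotv_ge0.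
Qed.

Lemma dist2_0 : dist2 0 = dotv (x0 - xs) (x0 - xs).
Proof.
have m0 w : mean 0 w = x0 by rewrite /mean avgv_cst.
by rewrite /dist2; under eq_Rintegral do rewrite m0; rewrite Ex_cst.
Qed.

(** * The weighted average of the iterates *)

Section Output.
Let q := 1 - mu * eta.
Let W := \sum_(t < T) q ^+ (T - t - 1).
Let out w := sgd_output f mu T x0 eta I (fun t k => xi t k w).
Hypothesis q0 : 0 <= q.
Hypothesis W0 : 0 < W.

Lemma sgd_outputE w : out w = W^-1 *: \sum_(t < T) q ^+ (T - t - 1) *: mean t w.
Proof.
rewrite /out /sgd_output -/W invfM mulrC -scalerA scaler_sumr; congr (_ *: _).
by apply: eq_bigr => t _; rewrite scalerA mulrC -scalerA.
Qed.

Lemma vsqitg_output : vsqitg P out.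
Proof.
rewrite (_ : out = fun w => W^-1 *: \sum_(t < T) q ^+ (T - t - 1) *: mean t w).
  apply: vsqitgZ; apply: vsqitg_sum => t _; apply: vsqitgZ; exact/vsqitg_mean/ltnW.
by apply/funext => w; exact: sgd_outputE.
Qed.

Lemma Ex_output :
  Ex (fun w => global_obj D f (out w) - global_obj D f xs) <=
  W^-1 * \sum_(t < T) q ^+ (T - t - 1) * subopt t.
Proof.
have ig (t : 'I_T) : itg P (fun w => q ^+ (T - t - 1) * (global_obj D f (mean t w) - global_obj D f xs)).
  by apply: itgZ; apply: itg_suboptimality; exact/vsqitg_mean/ltnW.
rewrite -(eq_bigr _ (fun (t : 'I_T) _ => ExZ _ (itg_suboptimality (vsqitg_mean (ltnW (ltn_ord t)))))).
rewrite -Ex_sum// -ExZ; last exact: itg_sum.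
apply: Ex_le => [||w]; first exact/itg_suboptimality/vsqitg_output.
  by apply: itgZ; exact: itg_sum.
have := global_obj_jensen n0 fint fcs (fun t : 'I_T => mean t w)
  (fun t : 'I_T => exprn_ge0 (T - t - 1) q0) W0.
rewrite -/W -sgd_outputE => h.
under eq_bigr do rewrite mulrBr.
by rewrite sumrB -mulr_suml -/W mulrBr mulKf ?gt_eqF// lerD2r.
Qed.

End Output.

Lemma error_le (E : nat) (B : R) : (0 < T)%N -> (0 < E)%N -> gap T I = E ->
  0 < eta -> eta * (L * E%:R) <= 64^-1 -> mu * eta * E%:R <= 2^-1 ->
  dotv (x0 - xs) (x0 - xs) <= B ^+ 2 ->
  ('E_P[fun w => (global_obj D f (sgd_output f mu T x0 eta I (fun t k => xi t k w))
     - global_obj D f xs)%R] <= (error_bound n T E L mu B sigma zeta eta)%:E)%E.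
Proof.
move=> T0 E0 gapE eta_gt etaLE etamuE xB.
set q := 1 - mu * eta; set W := \sum_(t < T) q ^+ (T - t - 1).
have E1 : 1 <= E%:R :> R by rewrite ler1n.
have q0 : 0 <= q.
  have : mu * eta <= mu * eta * E%:R by rewrite ler_peMr ?mulr_ge0.
  by rewrite /q; lra.
have W1 : 1 <= W by exact: weight_sum_ge1.
have W0 : 0 < W by rewrite (lt_le_trans ltr01).
rewrite unlock integral_Ex; last exact/itg_suboptimality/vsqitg_output.
rewrite lee_fin; apply: le_trans (Ex_output q0 W0) _.
have n1 : 1 <= n%:R :> R by rewrite ler1n.
have a0 : 0 <= (n%:R - 1) / n%:R * sigma ^+ 2.
  by rewrite mulr_ge0 ?sqr_ge0// divr_ge0// subr_ge0.
have drifted t : (t < T)%N -> exists2 t0, (t0 <= t < t0 + E)%N & spread t <= 3 * eta ^+ 2 * (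
    (t - t0)%:R * \sum_(t0 <= i < t) (2 * L ^+ 2 * spread i + 8 * L * subopt i)
    + (t - t0)%:R * ((n%:R - 1) / n%:R * sigma ^+ 2) + (t - t0)%:R ^+ 2 * zeta ^+ 2).
  move=> tT; have [t0 [/andP[t0t tE] sync nosync]] := gap_window I tT.
  exists t0; first by rewrite t0t -gapE.
  exact: spread_le t0t (ltnW tT) sync nosync.
have := weighted_recursion E0 L0 eta_gt mu0 etaLE etamuE a0 (sqr_ge0 zeta)
  dist2_ge0 subopt_ge0 spread_ge0 dist2_step drifted.
rewrite -/q -/W dist2_0.
set Se := \sum_(t < T) _ * subopt t; set Delta := (E%:R - 1) * _ => h.
have Dd : Delta <= (E%:R - 1) * drift n E sigma zeta.
  rewrite ler_wpM2l ?subr_ge0// /drift addrC lerD2r ler_wpM2r ?sqr_ge0//; lra.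
rewrite /error_bound -/q -/W.
have -> : W^-1 * Se = eta * Se / (eta * W) by field; rewrite !gt_eqF.
have hB : q ^+ T * dotv (x0 - xs) (x0 - xs) <= q ^+ T * B ^+ 2.
  by rewrite ler_wpM2l ?exprn_ge0.
have hD : 18 * eta ^+ 3 * L * Delta <= 18 * eta ^+ 3 * L * ((E%:R - 1) * drift n E sigma zeta).
  by rewrite ler_wpM2l// !mulr_ge0// exprn_ge0.
have hDW := ler_wpM2r (ltW W0) hD.
rewrite ler_pdivrMr ?mulr_gt0//; apply: le_trans h _.
rewrite [leRHS](_ : _ = q ^+ T * B ^+ 2
   + (18 * eta ^+ 3 * L * ((E%:R - 1) * drift n E sigma zeta)) * W
   + 2 * eta ^+ 2 * (sigma ^+ 2 / n%:R) * W); first by lra.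
by field; rewrite !gt_eqF// ltr0n.
Qed.

End LocalSGD.

Lemma convex_rate_ge0 (R : realType) (n T E : nat) (L B sigma zeta : R) :
  0 <= L -> 0 < B -> 0 <= sigma -> 0 <= convex_rate n T E L B sigma zeta.
Proof.
move=> L0 /ltW B0 s0; rewrite /convex_rate !addr_ge0//.
- by rewrite divr_ge0// !mulr_ge0// exprn_ge0.
- by rewrite divr_ge0 ?mulr_ge0 ?sqrtr_ge0.
- by rewrite !mulr_ge0 ?invr_ge0 ?powR_ge0.
Qed.

Lemma strongly_convex_rate_ge0 (R : realType) (n T E : nat) (L mu B sigma zeta c : R) :
  (0 < n)%N -> (0 < E)%N -> 0 <= L -> 0 <= mu ->
  0 <= strongly_convex_rate n T E L mu B sigma zeta c.
Proof.
move=> n0 E0 L0 mu0; rewrite /strongly_convex_rate addr_ge0//.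
  by rewrite mulr_ge0 ?expR_ge0// mulr_ge0 ?sqr_ge0// mulr_ge0.
exact: stochastic_terms_ge0.
Qed.

(** The rate is fixed before the problem is known, so one must also exist when [L = 0] or
    [mu > 2 * L]; there only its size is prescribed. *)
Lemma tuned_rate (R : realType) (n T E : nat) (L mu B sigma zeta : R) :
  (0 < n)%N -> (0 < T)%N -> (0 < E)%N -> 0 <= L -> 0 <= mu -> 0 < B -> 0 <= sigma ->
  exists eta, [/\ 0 < eta, eta * (mu + L * E%:R) <= 64^-1 &
    0 < L -> mu <= 2 * L ->
    (mu = 0 -> error_bound n T E L mu B sigma zeta eta <=
       256 * convex_rate n T E L B sigma zeta) /\
    (0 < mu -> error_bound n T E L mu B sigma zeta eta <=
       256 * log_factor n T E L mu B sigma zeta ^+ 2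
       * strongly_convex_rate n T E L mu B sigma zeta 192^-1)].
Proof.
move=> n0 T0 E0 L0 mu0 B0 s0.
have [good|bad] := boolP ((0 < L) && (mu <= 2 * L)); last first.
  pose m := mu + L * E%:R + 1.
  have m0 : 0 < m by rewrite ltr_wpDl// addr_ge0// mulr_ge0.
  exists (64 * m)^-1; split.
  - by rewrite invr_gt0 mulr_gt0.
  - rewrite invfM -mulrA ler_piMr// mulrC ler_pdivrMr// /m; lra.
  - by move=> Lp muL; rewrite Lp muL in bad.
have /andP[Lp muL] := good.
move: mu0; rewrite le_eqVlt => /predU1P[<-|mup].
  have [eta [e0 e1 e2]] := tuned_convex zeta n0 T0 E0 Lp B0 s0.
  exists eta; split=> //; first by rewrite add0r.
  move=> _ _; split=> [_|]; last by rewrite ltxx.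
  apply: le_trans e2 _; rewrite ler_wpM2r ?convex_rate_ge0//; lra.
have [eta [e0 e1 e2]] := tuned_strongly_convex B sigma zeta n0 T0 E0 mup muL.
exists eta; split=> // _ _; split=> // mu00.
by rewrite mu00 ltxx in mup.
Qed.

(* [C], [c], [c'] and [p] are the absolute constants of the O, Theta and tilde-O
   notations. The learning rate [eta] is tuned from the numerical parameters
   only. The condition eta <= c / (mu + L E) is written without division, since
   mu = L = 0 is allowed. *)
Theorem corollary6p1 (R : realType) :
  exists (C c c' : R) (p : nat), [/\ 0 < C, 0 < c & 0 < c'] /\
  forall (n T E : nat) (L mu B sigma zeta : R),
    (0 < n)%N -> (0 < T)%N -> (0 < E)%N ->
    0 <= L -> 0 <= mu -> 0 < B -> 0 <= sigma -> 0 <= zeta ->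
  exists eta : R, [/\ 0 < eta, eta * (mu + L * E%:R) <= c &
  forall (d : nat) (dX dO : measure_display)
    (Xi : 'I_n -> measurableType dX)
    (D : forall k, probability (Xi k) R)
    (f : forall k, 'rV[R]_d -> Xi k -> R)
    (Ls mus : 'I_n -> R) (xstar x0 : 'rV[R]_d) (I : seq nat)
    (Omega : measurableType dO) (P : probability Omega R)
    (xi : nat -> forall k, {mfun Omega >-> Xi k}),
    (forall k x, (D k).-integrable setT (EFin \o f k x)) ->
    (forall k, 0 <= Ls k) ->
    (forall k (z : Xi k), convex_smooth (Ls k) (fun x => f k x z)) ->
    (forall k, 0 <= mus k) ->
    (forall k, strongly_convex D f k (mus k)) ->
    is_max Ls L ->
    is_min mus mu ->
    (forall y, global_obj D f xstar <= global_obj D f y) ->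
    (sigma ^+ 2)%:E = noise_at D f xstar ->
    zeta ^+ 2 = heterogeneity_at D f xstar ->
    norm2 (x0 - xstar) <= B ->
    all (fun t => t <= T)%N I ->
    gap T I = E ->
    (forall t k A, (t < T)%N -> measurable A ->
       distribution P (xi t k) A = D k A) ->
    mutually_independent P
      (fun q : 'I_T * 'I_n => (xi q.1 q.2 : Omega -> Xi q.2)) ->
  let xhat w := sgd_output f mu T x0 eta I (fun t k => xi t k w) in
  let err := ('E_P[fun w => (global_obj D f (xhat w) - global_obj D f xstar)%R])%E in
  (mu = 0 -> (err <= (C * convex_rate n T E L B sigma zeta)%:E)%E) /\
  (0 < mu ->
     (err <= (C * log_factor n T E L mu B sigma zeta ^+ p
              * strongly_convex_rate n T E L mu B sigma zeta c')%:E)%E)].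
Proof.
(* The power 2 of the logarithm comes from the drift term, which is quadratic in [eta]. *)
exists 256, 64^-1, 192^-1, 2%N; split.
  by rewrite !invr_gt0; split; exact: ltr0n.
move=> n T E L mu B sigma zeta n0 T0 E0 L0 mu0 B0 sigma0 zeta0.
have [eta [eta_gt etac rate]] := tuned_rate zeta n0 T0 E0 L0 mu0 B0 sigma0.
exists eta; split=> //.
move=> d dX dO Xi D f Ls mus xs x0 I Omega P xi fint Ls0 fcs mus0 fsc [_ LsL] [_ musmu]
  xsmin noise hetero x0B _ gapE distxi indep xhat err.
have csL k z : convex_smooth L (fun x => f k x z).
  have [c1 c2 c3] := fcs k z; split=> // x y.
  by apply: le_trans (c3 x y) _; rewrite ler_wpM2r ?norm2_ge0.
have scmu k y x : mu / 2 * dotv (y - x) (y - x) <= local_breg D f k y x.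
  have musmu' : mu / 2 * dotv (y - x) (y - x) <= mus k / 2 * dotv (y - x) (y - x).
    by rewrite ler_wpM2r ?dotv_ge0// ler_pdivrMr// divfK.
  by have := fsc k x y; rewrite norm2_sqr dotvBC /local_breg; lra.
have suboptimality_le y : global_obj D f y - global_obj D f xs <= L * dotv (y - xs) (y - xs).
  exact: suboptimality_le n0 L0 fint csL xsmin _.
(* Strong convexity and smoothness give [(mu / 2 - L) * |y - xs| ^+ 2 <= 0], so
   if [L = 0] or [mu > 2 * L] the objective is constant. *)
have [/andP[Lp muL]|degenerate] := boolP ((0 < L) && (mu <= 2 * L)); last first.
  have flat y : global_obj D f y - global_obj D f xs = 0.
    apply/eqP; rewrite eq_le subr_ge0 xsmin andbT.
    move: degenerate; rewrite negb_and -leNgt -ltNge => /orP[L0'|muL].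
      apply: le_trans (suboptimality_le y) _.
      by rewrite mulr_le0_ge0 ?dotv_ge0.
    apply: le_trans (suboptimality_le y) _.
    have := local_breg_le L0 fint csL (Ordinal n0) y xs.
    have := scmu (Ordinal n0) y xs; have := dotv_ge0 (y - xs).
    move: (dotv (y - xs) (y - xs)) => r r0 h1 h2.
    have : (mu / 2 - L) * r <= 0 by lra.
    rewrite pmulr_rle0 => [r_le|]; last by lra.
    by rewrite mulr_ge0_le0.
  have -> : err = 0%E.
    rewrite /err unlock; apply: integral0_eq => w _.
    by rewrite flat.
  split=> _; rewrite lee_fin.
    by apply: mulr_ge0; [exact: ler0n|exact: convex_rate_ge0].
  apply: mulr_ge0; last exact: strongly_convex_rate_ge0.
  by apply: mulr_ge0; [exact: ler0n|exact: sqr_ge0].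
have etaLE : eta * (L * E%:R) <= 64^-1.
  by apply: le_trans etac; rewrite ler_wpM2l ?lerDr// ltW.
(* The size condition on [eta] bounds [mu] without the factor [E]; [mu <= 2 * L] reduces the claim
   to [etaLE]. *)
have etamuE : mu * eta * E%:R <= 2^-1.
  have : eta * E%:R * mu <= eta * E%:R * (2 * L).
    by rewrite ler_wpM2l ?mulr_ge0// ltW.
  lra.
have x0B2 : dotv (x0 - xs) (x0 - xs) <= B ^+ 2.
  by rewrite -norm2_sqr lerXn2r ?nnegrE ?norm2_ge0 ?(ltW B0).
have bound : (err <= (error_bound n T E L mu B sigma zeta eta)%:E)%E.
  exact: (error_le n0 L0 (ltW eta_gt) mu0 fint csL scmu xsmin noise hetero distxi indep).
have [rc rs] := rate Lp muL.
split=> [/rc|/rs] h; apply: le_trans bound _; rewrite lee_fin//.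
Qed.
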